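(* Let $A=\mathcal{L}_J(H_{\mathcal A})$ be the restricted Banach $*$-algebra, let $P(A)$ be its set of idempotents, let $p\in P(A)$, and let $\Lambda=\mathrm{Sim}(p,A)$ be the similarity class of $p$ in $A$. Then $\Lambda$ is an open and closed holomorphic (Banach) submanifold of $P(A)$, where $P(A)$ is itself a holomorphic (Banach) submanifold of $A$.
   Context: The algebra $A$. Let $H$ be a separable infinite-dimensional complex Hilbert space (for instance $H=L^2(S^1,\mathbb{C})$), and let $J$ be a unitary operator on $H$ with $J^2=1$, whose $\pm1$ eigenspaces give a polarization of $H$. Put $B=\mathcal{L}_J(H)=\{T\in\mathcal{L}(H): [J,T] \text{ is Hilbert--Schmidt}\}$, a unital complex Banach($-$able) $*$-algebra with norm $\|T\|_J=\|T\|+\|[J,T]\|_2$, where $\|\cdot\|_2$ is the Hilbert--Schmidt norm. Let $\mathcal A$ be a commutative separable unital C*-algebra, so $\mathcal A\cong C(Y)$ with $Y=\mathrm{Spec}(\mathcal A)$ a compact metric space, and let $H_{\mathcal A}$ be the standard (free, countable-dimensional) Hilbert module over $\mathcal A$. The restricted algebra $A=\mathcal{L}_J(H_{\mathcal A})$ is identified with the unital complex Banach algebra $C(Y,B)$ of continuous functions $Y\to B$ (pointwise operations, supremum norm). Notation. $G(A)$ is the group of invertible elements of $A$; $P(A)=\{q\in A: q^2=q\}$ is the set of (not necessarily self-adjoint) idempotents, with the topology induced from $A$; $\mathrm{Sim}(p,A)=\{gpg^{-1}: g\in G(A)\}$. A holomorphic Banach submanifold is a complex analytic submanifold modeled on complex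 Banach spaces. *)

(* Defs.v *)
From HB Require Import structures.
From mathcomp Require Import all_boot all_order all_algebra.
From mathcomp Require Import all_classical all_reals all_analysis.
From mathcomp Require Import complex.
From mathcomp Require Import ring lra.
Set Implicit Arguments. Unset Strict Implicit. Unset Printing Implicit Defensive.
Import Order.TTheory GRing.Theory Num.Theory.
Import numFieldNormedType.Exports.
Local Open Scope classical_set_scope.
Local Open Scope ring_scope.
Local Open Scope complex_scope.

(* The norm of a normed module over R[i] takes its values in R[i]; rnorm is
   the same norm read in R, and cabs the modulus of a scalar. *)
Definition rnorm (R : realType) (V : normedModType R[i]) (x : V) : R :=
  complex.Re `|x|.

Section rnorm_theory.
Context {R : realType} {V : normedModType R[i]}.
Implicit Types x y : V.

Lemma rnormE x : (rnorm x)%:C = `|x|.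
Proof. by rewrite /rnorm RRe_real//. Qed.

Lemma rnorm_ge0 x : 0 <= rnorm x.
Proof. by rewrite -lecR rnormE normr_ge0. Qed.

Lemma rnorm_le x (M : R) : (rnorm x <= M) = (`|x| <= M%:C).
Proof. by rewrite -lecR rnormE. Qed.

Lemma rnorm_lt x (M : R) : (rnorm x < M) = (`|x| < M%:C).
Proof. by rewrite -ltcR rnormE. Qed.

Lemma rnormD x y : rnorm (x + y) <= rnorm x + rnorm y.
Proof. by rewrite rnorm_le rmorphD/= !rnormE ler_normD. Qed.

Lemma rnormN x : rnorm (- x) = rnorm x.
Proof. by rewrite /rnorm normrN. Qed.

Lemma rnormB x y : rnorm (x - y) <= rnorm x + rnorm y.
Proof. by rewrite -(rnormN y) rnormD. Qed.

Lemma rnorm0 : rnorm (0 : V) = 0.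
Proof. by rewrite /rnorm normr0. Qed.

Lemma rnorm0_eq0 x : rnorm x = 0 -> x = 0.
Proof. by move=> x0; apply/normr0_eq0; rewrite -rnormE x0. Qed.

Lemma rnorm_distC x y : rnorm (x - y) = rnorm (y - x).
Proof. by rewrite -rnormN opprB. Qed.

End rnorm_theory.

Section cabs.
Context {R : realType}.
Implicit Types a b : R[i].

Definition cabs a : R := complex.Re `|a|.

Lemma cabsE a : (cabs a)%:C = `|a|.
Proof. by rewrite /cabs RRe_real ?normr_real. Qed.

Lemma cabs_ge0 a : 0 <= cabs a.
Proof. by rewrite -lecR cabsE normr_ge0. Qed.

Lemma cabsM a b : cabs (a * b) = cabs a * cabs b.
Proof. by apply: (@complexI R); rewrite rmorphM/= !cabsE normrM. Qed.

Lemma cabsD a b : cabs (a + b) <= cabs a + cabs b.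
Proof. by rewrite -lecR rmorphD/= !cabsE ler_normD. Qed.

Lemma cabs0 : cabs 0 = 0.
Proof. by rewrite /cabs normr0. Qed.

Lemma cabs0_eq0 a : cabs a = 0 -> a = 0.
Proof. by move=> a0; apply/normr0_eq0; rewrite -cabsE a0. Qed.

Lemma cabs_conj a : cabs (Num.conj a) = cabs a.
Proof. by rewrite /cabs norm_conjC. Qed.

Lemma cabs_real (r : R) : 0 <= r -> cabs r%:C = r.
Proof. by move=> r0; rewrite /cabs ger0_norm ?ler0c. Qed.

Lemma cabs_sq a : (cabs a ^+ 2)%:C = a * Num.conj a.
Proof. by rewrite rmorphXn/= cabsE normCK. Qed.

Lemma cabs_sum (F : nat -> R[i]) n :
  cabs (\sum_(i < n) F i) <= \sum_(i < n) cabs (F i).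
Proof.
elim: n => [|n ih]; first by rewrite !big_ord0 cabs0.
by rewrite !big_ord_recr/= (le_trans (cabsD _ _))// lerD2r.
Qed.

End cabs.

Lemma rnormZ (R : realType) (V : normedModType R[i]) (a : R[i]) (x : V) :
  rnorm (a *: x) = cabs a * rnorm x.
Proof. by apply: (@complexI R); rewrite rmorphM/= !rnormE cabsE normrZ. Qed.

Lemma rnorm_sum (R : realType) (V : normedModType R[i]) (F : nat -> V) n :
  rnorm (\sum_(i < n) F i) <= \sum_(i < n) rnorm (F i).
Proof.
elim: n => [|n ih]; first by rewrite !big_ord0 rnorm0.
by rewrite !big_ord_recr/= (le_trans (rnormD _ _))// lerD2r.
Qed.

Section finite_sums.
Context {R : realType}.
Implicit Types a b : nat -> R.

Lemma sumsq_ge0 a n : 0 <= \sum_(i < n) a i ^+ 2.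
Proof. by apply: sumr_ge0 => i _; rewrite sqr_ge0. Qed.

Lemma sum_CauchySchwarz a b n :
  (\sum_(i < n) a i * b i) ^+ 2 <=
  (\sum_(i < n) a i ^+ 2) * (\sum_(i < n) b i ^+ 2).
Proof.
set P := \sum_(i < n) a i * b i; set A := \sum_(i < n) a i ^+ 2.
set B := \sum_(i < n) b i ^+ 2.
have B0 : 0 <= B by exact: sumsq_ge0.
have : 0 <= \sum_(i < n) (B * a i - P * b i) ^+ 2.
  by apply: sumr_ge0 => i _; exact: sqr_ge0.
have E (u v : R) : \sum_(i < n) (u * a i - v * b i) ^+ 2 =
    u ^+ 2 * A + (- (2 * u * v)) * P + v ^+ 2 * B.
  rewrite /A /B /P !mulr_sumr -!big_split/=.
  by apply: eq_bigr => i _; ring.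
have -> : \sum_(i < n) (B * a i - P * b i) ^+ 2 = B * (A * B - P ^+ 2).
  by rewrite E; ring.
have [B00|Bn0] := eqVneq B 0; last first.
  by rewrite pmulr_rge0 ?subr_ge0// lt0r Bn0.
move=> _; suff -> : P = 0 by rewrite expr0n mulr_ge0// sumsq_ge0.
rewrite /P big1// => i _; suff -> : b i = 0 by rewrite mulr0.
apply/eqP; rewrite -sqrf_eq0; apply/eqP.
by apply: (psumr_eq0P (fun (j : 'I_n) _ => sqr_ge0 (b j)) B00).
Qed.

Lemma sum_Minkowski a b n (M N : R) : 0 <= M -> 0 <= N ->
  \sum_(i < n) a i ^+ 2 <= M ^+ 2 -> \sum_(i < n) b i ^+ 2 <= N ^+ 2 ->
  \sum_(i < n) (a i + b i) ^+ 2 <= (M + N) ^+ 2.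
Proof.
move=> M0 N0 aM bN.
have /le_trans H := sum_CauchySchwarz a b n.
have {}H : (\sum_(i < n) a i * b i) ^+ 2 <= (M * N) ^+ 2.
  by apply: H; rewrite exprMn ler_pM// sumsq_ge0.
have PMN : \sum_(i < n) a i * b i <= M * N.
  rewrite (le_trans (ler_norm _))// -ler_sqr ?nnegrE ?mulr_ge0//.
  by rewrite real_normK ?num_real.
have -> : \sum_(i < n) (a i + b i) ^+ 2 = \sum_(i < n) a i ^+ 2 +
    2 * (\sum_(i < n) a i * b i) + \sum_(i < n) b i ^+ 2.
  by rewrite mulr_sumr -!big_split/=; apply: eq_bigr => i _; ring.
by lra.
Qed.

End finite_sums.

(* The inner product is linear in its first argument and conjugate-linear in
   the second one. *)
HB.mixin Record CompleteNormedModule_isHilbert (R : realType) H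
    & CompleteNormedModule R[i] H := {
  hdot : {dot H for (@Num.conj R[i])} ;
  hdot_norm : forall x : H, `|x| ^+ 2 = hdot x x
}.

#[short(type="hilbertType")]
HB.structure Definition Hilbert (R : realType) :=
  {H of CompleteNormedModule R[i] H & CompleteNormedModule_isHilbert R H}.

HB.mixin Record Metric_isCompact (R : realType) Y & Metric R Y := {
  compact_setT : compact [set: Y]
}.

#[short(type="compactMetricType")]
HB.structure Definition CompactMetric (R : realType) :=
  {Y of Metric R Y & Metric_isCompact R Y}.

Section hilbert.
Context {R : realType}.

Definition separable (T : topologicalType) :=
  exists2 D : set T, countable D & dense D.

Definition infinite_dimensional (V : lmodType R[i]) :=
  forall n (v : 'I_n -> V), exists x, forall a : 'I_n -> R[i],
    x <> \sum_(i < n) a i *: v i.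

Variable H : hilbertType R.

Definition orthonormal_basis (e : nat -> H) :=
  (forall i j, hdot (e i) (e j) = (i == j)%:R) /\
  dense [set x | exists n (a : nat -> R[i]), x = \sum_(i < n) a i *: e i].

End hilbert.

Section hilbert_theory.
Context {R : realType} {H : hilbertType R}.
Implicit Types x y z : H.

Lemma hdot_sym x y : hdot x y = Num.conj (hdot y x).
Proof. by rewrite (@hermitian_subproof _ _ _ _ (@hdot R H)) expr0 mul1r. Qed.

Lemma hdotDl x y z : hdot (x + y) z = hdot x z + hdot y z.
Proof. by rewrite linearDl. Qed.

Lemma hdotZl a x z : hdot (a *: x) z = a * hdot x z.
Proof. by rewrite linearZl. Qed.

Lemma hdotDr x y z : hdot z (x + y) = hdot z x + hdot z y.
Proof. by rewrite hdot_sym hdotDl rmorphD/= -!(hdot_sym z). Qed.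

Lemma hdotZr a x z : hdot z (a *: x) = Num.conj a * hdot z x.
Proof. by rewrite hdot_sym hdotZl rmorphM/= -(hdot_sym z). Qed.

Lemma hdot0l x : hdot 0 x = 0.
Proof. by rewrite -(scale0r 0) hdotZl mul0r. Qed.

Lemma hdot0r x : hdot x 0 = 0.
Proof. by rewrite hdot_sym hdot0l rmorph0. Qed.

Lemma rnorm_sq x : (rnorm x ^+ 2)%:C = hdot x x.
Proof. by rewrite rmorphXn/= rnormE hdot_norm. Qed.

Lemma cabs_hdotC x y : cabs (hdot x y) = cabs (hdot y x).
Proof. by rewrite hdot_sym cabs_conj. Qed.

Lemma hdot_CauchySchwarz x y : cabs (hdot x y) <= rnorm x * rnorm y.
Proof.
have [->|y0] := eqVneq y 0; first by rewrite hdot0r cabs0 rnorm0 mulr0.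
have ry : 0 < rnorm y.
  by rewrite lt0r rnorm_ge0 andbT; apply: contra y0 => /eqP/rnorm0_eq0 ->.
set a := hdot x y; have [b bE] : exists b, b = rnorm y ^+ 2 by eexists.
have b0 : 0 < b by rewrite bE exprn_gt0.
suff : (rnorm (b%:C *: x + (- a) *: y)) ^+ 2 = b * (b * rnorm x ^+ 2 - cabs a ^+ 2).
  move=> E; have : 0 <= b * (b * rnorm x ^+ 2 - cabs a ^+ 2).
    by rewrite -E sqr_ge0.
  rewrite pmulr_rge0// subr_ge0 bE -exprMn mulrC => h.
  by rewrite -ler_sqr ?nnegrE ?cabs_ge0 ?mulr_ge0 ?rnorm_ge0// mulrC.
apply: (@complexI R); rewrite rnorm_sq.
have cR (r : R) : Num.conj r%:C = r%:C :> R[i].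
  by apply/CrealP; rewrite complex_real.
rewrite [RHS]rmorphM/= [(_ - _)%:C]rmorphB/= [(b * _)%:C]rmorphM/= cabs_sq.
rewrite !(hdotDl, hdotDr, hdotZl, hdotZr) -/a (hdot_sym y x) -/a -!rnorm_sq.
rewrite -bE rmorphN/= cR.
by ring.
Qed.

Lemma hdot_suml (a : nat -> R[i]) (e : nat -> H) n y :
  hdot (\sum_(i < n) a i *: e i) y = \sum_(i < n) a i * hdot (e i) y.
Proof.
elim: n => [|n ih]; first by rewrite !big_ord0 hdot0l.
by rewrite !big_ord_recr/= hdotDl ih hdotZl.
Qed.

Lemma onb_dot (a : nat -> R[i]) (e : nat -> H) n k : orthonormal_basis e ->
  hdot (\sum_(i < n) a i *: e i) (e k) = if (k < n)%N then a k else 0.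
Proof.
move=> [eE _]; rewrite hdot_suml.
under eq_bigr do rewrite eE.
case: ifPn => kn.
  rewrite (bigD1 (Ordinal kn))//= eqxx mulr1 big1 ?addr0// => i ik.
  case: eqVneq => [E|_]; last by rewrite mulr0.
  by move/eqP: ik; case; apply: val_inj.
rewrite big1// => i _; case: eqVneq => [E|_]; last by rewrite mulr0.
by move: kn; rewrite -E ltn_ord.
Qed.

Lemma onb_norm (a : nat -> R[i]) (e : nat -> H) n : orthonormal_basis e ->
  rnorm (\sum_(i < n) a i *: e i) ^+ 2 = \sum_(i < n) cabs (a i) ^+ 2.
Proof.
move=> eb; apply: (@complexI R); rewrite rnorm_sq rmorph_sum/= {1}hdot_suml.
apply: eq_bigr => i _; rewrite hdot_sym onb_dot// ltn_ord.
by rewrite cabs_sq.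
Qed.

Section functional.
Variable f : H -> R[i].
Hypothesis flin : forall a x y, f (a *: x + y) = a * f x + f y.

Lemma fun0 : f 0 = 0.
Proof. by move: (flin (- 1) 0 0); rewrite scaler0 addr0 mulN1r addNr. Qed.

Lemma funD x y : f (x + y) = f x + f y.
Proof. by rewrite -{1}(scale1r x) flin mul1r. Qed.

Lemma fun_sum (a : nat -> R[i]) (e : nat -> H) n :
  f (\sum_(i < n) a i *: e i) = \sum_(i < n) a i * f (e i).
Proof.
elim: n => [|n ih]; first by rewrite !big_ord0 fun0.
by rewrite !big_ord_recr/= addrC flin ih addrC.
Qed.

Lemma functional_Bessel (e : nat -> H) q n : orthonormal_basis e -> 0 <= q ->
  (forall x, cabs (f x) <= q * rnorm x) ->
  \sum_(i < n) cabs (f (e i)) ^+ 2 <= q ^+ 2.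
Proof.
move=> eb q0 fq; pose v := \sum_(i < n) Num.conj (f (e i)) *: e i.
set s := leLHS; have s0 : 0 <= s by exact: (sumsq_ge0 (fun i => cabs (f (e i)))).
have fv : f v = s%:C.
  rewrite /v (@fun_sum (fun i => Num.conj (f (e i)))) /s rmorph_sum/=.
  by apply: eq_bigr => i _; rewrite cabs_sq mulrC.
have nv : rnorm v ^+ 2 = s.
  rewrite /v (@onb_norm (fun i => Num.conj (f (e i))))//.
  by apply: eq_bigr => i _; rewrite cabs_conj.
have := fq v; rewrite fv cabs_real// => sv.
have : s * s <= q ^+ 2 * s.
  by rewrite -{3}nv -exprMn -expr2 ler_sqr ?nnegrE ?mulr_ge0 ?rnorm_ge0.
have [->|sn0] := eqVneq s 0; first by rewrite sqr_ge0.
by rewrite ler_pM2r// lt0r sn0.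
Qed.

Lemma functional_le (e : nat -> H) K Q : orthonormal_basis e ->
  (forall x, cabs (f x) <= K * rnorm x) -> 0 <= Q ->
  (forall n, \sum_(i < n) cabs (f (e i)) ^+ 2 <= Q ^+ 2) ->
  forall x, cabs (f x) <= Q * rnorm x.
Proof.
move=> eb fK Q0 fQ x; apply/ler_addgt0Pr => eps eps0.
pose K' := `|K|; have fK' z : cabs (f z) <= K' * rnorm z.
  by rewrite (le_trans (fK z))// ler_wpM2r ?rnorm_ge0 ?ler_norm.
have K'0 : 0 <= K' by exact: normr_ge0.
pose d := eps / (Q + K' + 1).
have QK : 0 < Q + K' + 1 by rewrite ltr_wpDl// addr_ge0.
have d0 : 0 < d by rewrite divr_gt0.
have /(_ (ball x d%:C)) := eb.2; case.
- by exists x; apply: ballxx; rewrite ltcR.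
- by apply: ball_open; rewrite ltcR.
move=> y [+ [n [a yE]]]; rewrite -ball_normE /ball_/= -rnorm_lt => xy.
have fy : cabs (f y) <= Q * rnorm y.
  rewrite yE fun_sum (le_trans (@cabs_sum _ (fun i => a i * f (e i)) n))//.
  rewrite -ler_sqr ?nnegrE ?mulr_ge0 ?rnorm_ge0//; last first.
    by apply: sumr_ge0 => i _; rewrite cabs_ge0.
  under eq_bigr do rewrite cabsM.
  rewrite (le_trans (@sum_CauchySchwarz _ (fun i => cabs (a i))
    (fun i => cabs (f (e i))) n))//.
  rewrite exprMn mulrC onb_norm// ler_wpM2r//.
  exact: (sumsq_ge0 (fun i => cabs (a i))).
have -> : x = (x - y) + y by rewrite subrK.
rewrite funD (le_trans (cabsD _ _))//.
have nyx : rnorm y <= d + rnorm (x - y + y).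
  rewrite subrK; have -> : y = x - (x - y) by rewrite opprB addrC subrK.
  by rewrite (le_trans (rnormB _ _))// addrC lerD2r ltW.
have : cabs (f (x - y)) <= K' * d.
  by rewrite (le_trans (fK' _))// ler_wpM2l// ltW.
have : Q * rnorm y <= Q * (d + rnorm (x - y + y)) by rewrite ler_wpM2l.
have : eps = (Q + K' + 1) * d by rewrite /d mulrC divfK// gt_eqF.
move: fy; set u := cabs _; set v := cabs _; set w := rnorm (_ + _).
by move=> h1 -> h2 h3; nra.
Qed.

End functional.

Lemma Bessel (e : nat -> H) n x : orthonormal_basis e ->
  \sum_(i < n) cabs (hdot x (e i)) ^+ 2 <= rnorm x ^+ 2.
Proof.
move=> eb; under eq_bigr do rewrite cabs_hdotC.
apply: (@functional_Bessel (fun y => hdot y x)) => //; last 2 first.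
- exact: rnorm_ge0.
- by move=> y; rewrite mulrC hdot_CauchySchwarz.
- by move=> a y z; rewrite hdotDl hdotZl.
Qed.

Lemma Parseval_le (e : nat -> H) x M : orthonormal_basis e -> 0 <= M ->
  (forall n, \sum_(i < n) cabs (hdot x (e i)) ^+ 2 <= M ^+ 2) -> rnorm x <= M.
Proof.
move=> eb M0 h.
have : cabs (hdot x x) <= M * rnorm x.
  apply: (@functional_le (fun y => hdot y x) _ e (rnorm x)) => //.
  - by move=> a y z; rewrite hdotDl hdotZl.
  - by move=> y; rewrite mulrC hdot_CauchySchwarz.
  - by move=> n; under eq_bigr do rewrite cabs_hdotC.
rewrite -rnorm_sq cabs_real ?sqr_ge0// expr2.
have [->//|x0] := eqVneq (rnorm x) 0.
by rewrite ler_pM2r// lt0r x0 rnorm_ge0.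
Qed.

Lemma Parseval (e : nat -> H) x : orthonormal_basis e ->
  (rnorm x ^+ 2)%:E = (\sum_(i <oo) (cabs (hdot x (e i)) ^+ 2)%:E)%E.
Proof.
move=> eb; apply/eqP; rewrite eq_le; apply/andP; split; last first.
  apply: lime_le.
    by apply: is_cvg_nneseries => i _ _; rewrite lee_fin sqr_ge0.
  by apply: nearW => n; rewrite big_mkord sumEFin lee_fin Bessel.
have : (0 <= \sum_(i <oo) (cabs (hdot x (e i)) ^+ 2)%:E)%E.
  by apply: nneseries_ge0 => i _ _; rewrite lee_fin sqr_ge0.
case E : (\sum_(i <oo) (cabs (hdot x (e i)) ^+ 2)%:E)%E => [r| |]//; last first.
  by move=> _; rewrite leey.
rewrite lee_fin => r0; rewrite lee_fin.
rewrite -(sqr_sqrtr r0) ler_sqr ?nnegrE ?rnorm_ge0 ?sqrtr_ge0//.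
apply: (Parseval_le eb); rewrite ?sqrtr_ge0// => n.
rewrite sqr_sqrtr// -lee_fin -E -sumEFin -(big_mkord xpredT (fun i => (cabs (hdot x (e i)) ^+ 2)%:E)).
by apply: nneseries_lim_ge => i _ _; rewrite lee_fin sqr_ge0.
Qed.

Definition hs_sum (e : nat -> H) (T : H -> H) : \bar R :=
  (\sum_(n <oo) (rnorm (T (e n)) ^+ 2)%:E)%E.

Lemma hs_sum_le e (T : H -> H) (M : R) :
  (hs_sum e T <= (M ^+ 2)%:E)%E <->
  forall n, \sum_(i < n) rnorm (T (e i)) ^+ 2 <= M ^+ 2.
Proof.
split=> [h n|h].
  rewrite -lee_fin (le_trans _ h)// -sumEFin.
  rewrite -(big_mkord xpredT (fun i => (rnorm (T (e i)) ^+ 2)%:E)).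
  by apply: nneseries_lim_ge => i _ _; rewrite lee_fin sqr_ge0.
apply: lime_le.
  by apply: is_cvg_nneseries => i _ _; rewrite lee_fin sqr_ge0.
by apply: nearW => n; rewrite big_mkord sumEFin lee_fin h.
Qed.

Lemma hs_sum_ge0 e (T : H -> H) : (0 <= hs_sum e T)%E.
Proof. by apply: nneseries_ge0 => i _ _; rewrite lee_fin sqr_ge0. Qed.

Definition linfun_bounded (T : H -> H) (K : R) :=
  (forall a x y, T (a *: x + y) = a *: T x + T y) /\
  (forall x, rnorm (T x) <= K * rnorm x).

(* With T = id and K = 1 this shows that the sum does not depend on the
   basis; in general it shows that S \o T is Hilbert-Schmidt whenever S is. *)
Lemma hs_sum_comp (e f : nat -> H) (S T : H -> H) (K L M : R) :
  orthonormal_basis e -> orthonormal_basis f ->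
  linfun_bounded S L -> linfun_bounded T K -> 0 <= K -> 0 <= M ->
  (hs_sum f S <= (M ^+ 2)%:E -> hs_sum e (S \o T) <= ((M * K) ^+ 2)%:E)%E.
Proof.
move=> eb fb [Sl SL] [Tl TK] K0 M0 fS.
pose P k := (\sum_(j <oo) (cabs (hdot (S (f j)) (f k)) ^+ 2)%:E)%E.
have P0 k : (0 <= P k)%E.
  by apply: nneseries_ge0 => i _ _; rewrite lee_fin sqr_ge0.
have PM : (\sum_(k <oo) P k <= (M ^+ 2)%:E)%E.
  rewrite /P nneseries_interchange; last by move=> i j; rewrite lee_fin sqr_ge0.
  by rewrite (le_trans _ fS)//; apply: lee_nneseries => i _ *;
     rewrite -?(Parseval _ fb)// lee_fin sqr_ge0.
have Pk k : (P k <= (M ^+ 2)%:E)%E.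
  rewrite (le_trans _ PM)//.
  apply: (@le_trans _ _ (\sum_(0 <= j < k.+1) P j)%E).
    by rewrite big_nat_recr//= leeDr// sume_ge0.
  exact: nneseries_lim_ge.
have Pfin k : P k = (fine (P k))%:E.
  by rewrite fineK// ge0_fin_numE// (le_lt_trans (Pk k))// ltry.
have key k n : \sum_(i < n) cabs (hdot (S (T (e i))) (f k)) ^+ 2 <=
    K ^+ 2 * fine (P k).
  have q0 : 0 <= Num.sqrt (fine (P k)) by exact: sqrtr_ge0.
  rewrite -(@sqr_sqrtr _ (fine (P k))) ?fine_ge0// -exprMn.
  apply: (@functional_Bessel (fun x => hdot (S (T x)) (f k))) => //.
  - by move=> a x y; rewrite Tl Sl hdotDl hdotZl.
  - by rewrite mulr_ge0.
  - move=> x.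
    have h y : cabs (hdot (S y) (f k)) <= Num.sqrt (fine (P k)) * rnorm y.
      apply: (@functional_le (fun y => hdot (S y) (f k)) _ f L) => //.
      + by move=> a u v; rewrite Sl hdotDl hdotZl.
      + move=> u; rewrite (le_trans (hdot_CauchySchwarz _ _))//.
        suff -> : rnorm (f k) = 1 by rewrite mulr1.
        apply/eqP; rewrite -(@eqrXn2 _ 2) ?rnorm_ge0// expr1n; apply/eqP.
        by apply: (@complexI R); rewrite rnorm_sq fb.1 eqxx.
      + move=> m; rewrite sqr_sqrtr ?fine_ge0// -lee_fin -Pfin -sumEFin.
        rewrite -(big_mkord xpredT (fun j => (cabs (hdot (S (f j)) (f k)) ^+ 2)%:E)).
        by apply: nneseries_lim_ge => i _ _; rewrite lee_fin sqr_ge0.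
    apply: le_trans (h _) _; by rewrite mulrAC mulrC ler_wpM2r.
apply/hs_sum_le => n; rewrite -lee_fin -sumEFin.
under eq_bigr do rewrite (Parseval _ fb).
rewrite -nneseries_sum; last by move=> i j _; rewrite lee_fin sqr_ge0.
apply: (@le_trans _ _ (\sum_(k <oo) ((K ^+ 2)%:E * P k))%E).
  apply: lee_nneseries => [k _ _|k _]; first by apply: sume_ge0 => i _; rewrite lee_fin sqr_ge0.
  by rewrite sumEFin Pfin -EFinM lee_fin key.
rewrite nneseriesZl//.
rewrite exprMn (mulrC (M ^+ 2)) EFinM; apply: lee_wpmul2l PM.
by rewrite lee_fin sqr_ge0.
Qed.

Lemma hs_sum_indep_le (e f : nat -> H) (S : H -> H) (L : R) :
  orthonormal_basis e -> orthonormal_basis f -> linfun_bounded S L ->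
  (hs_sum e S <= hs_sum f S)%E.
Proof.
move=> eb fb SL; have := hs_sum_ge0 f S.
case E : (hs_sum f S) => [r| |]//; last by move=> _; rewrite leey.
rewrite lee_fin => r0.
have := @hs_sum_comp e f S idfun 1 L (Num.sqrt r) eb fb SL.
rewrite mulr1 sqr_sqrtr// E; apply => //; rewrite ?sqrtr_ge0//.
by split=> // x; rewrite mul1r.
Qed.

Lemma hs_sum_indep (e f : nat -> H) (S : H -> H) (L : R) :
  orthonormal_basis e -> orthonormal_basis f -> linfun_bounded S L ->
  hs_sum e S = hs_sum f S.
Proof.
by move=> eb fb SL; apply/eqP; rewrite eq_le !(@hs_sum_indep_le _ _ S L).
Qed.

(* For a bounded operator T the sum hs_sum e T is the same for every
   orthonormal basis e (hs_sum_indep), so the supremum is this common value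
   (hs_sqE). Bases are indexed by nat: these definitions are meant for
   separable infinite-dimensional spaces only. *)
Definition hs_sq (T : H -> H) : \bar R :=
  ereal_sup [set hs_sum e T | e in @orthonormal_basis R H].

Definition hilbert_schmidt (T : H -> H) := (hs_sq T < +oo)%E.

Definition hs_norm (T : H -> H) : R := Num.sqrt (fine (hs_sq T)).

Lemma hs_sqE (e : nat -> H) (S : H -> H) (L : R) :
  orthonormal_basis e -> linfun_bounded S L -> hs_sq S = hs_sum e S.
Proof.
move=> eb SL; rewrite /hs_sq; apply/eqP; rewrite eq_le; apply/andP; split.
  by apply: ge_ereal_sup => _ [f fb <-]; rewrite (hs_sum_indep fb eb SL).
by apply: ereal_sup_ubound; exists e.
Qed.

Lemma hs_norm_ge0 T : 0 <= hs_norm T. Proof. exact: sqrtr_ge0. Qed.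

Lemma hs_normP T e n : hilbert_schmidt T -> orthonormal_basis e ->
  \sum_(i < n) rnorm (T (e i)) ^+ 2 <= hs_norm T ^+ 2.
Proof.
move=> hT eb.
suff /hs_sum_le : (hs_sum e T <= (hs_norm T ^+ 2)%:E)%E by apply.
have h : (hs_sum e T <= hs_sq T)%E by apply: ereal_sup_ubound; exists e.
have h0 : (0 <= hs_sq T)%E by rewrite (le_trans (hs_sum_ge0 e T)).
by rewrite /hs_norm sqr_sqrtr ?fine_ge0// fineK// ge0_fin_numE.
Qed.

Lemma hs_norm_le T M : 0 <= M ->
  (forall e, orthonormal_basis e ->
     forall n, \sum_(i < n) rnorm (T (e i)) ^+ 2 <= M ^+ 2) ->
  hilbert_schmidt T /\ hs_norm T <= M.
Proof.
move=> M0 hM; have h : (hs_sq T <= (M ^+ 2)%:E)%E.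
  by apply: ge_ereal_sup => _ [e eb <-]; apply/hs_sum_le => n; exact: hM.
split; first by rewrite /hilbert_schmidt (le_lt_trans h)// ltry.
rewrite /hs_norm; case: (hs_sq T) h => [r| |]//= h.
- by rewrite -(ger0_norm M0) -sqrtr_sqr ler_wsqrtr.
- by rewrite sqrtr0.
Qed.

Lemma hs_norm_bound T : hilbert_schmidt T <-> exists2 M, 0 <= M &
  (forall e, orthonormal_basis e ->
     forall n, \sum_(i < n) rnorm (T (e i)) ^+ 2 <= M ^+ 2).
Proof.
split=> [hT|[M M0 /(hs_norm_le M0)[]//]].
by exists (hs_norm T); [exact: hs_norm_ge0|move=> e eb n; exact: hs_normP].
Qed.


End hilbert_theory.

Section bounded_operators.
Context {R : realType}.
Variable H : hilbertType R.

Definition is_bounded_operator : pred (H -> H) :=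
  fun T => `[< linear T /\ continuous T >].

Record bounded_operator := BoundedOperator {
  bop_fun :> H -> H ;
  _ : is_bounded_operator bop_fun
}.

HB.instance Definition _ := [isSub for bop_fun].
HB.instance Definition _ := [Choice of bounded_operator by <:].

Lemma is_bounded_operatorP (T : H -> H) :
  is_bounded_operator T <-> exists2 K, 0 <= K & linfun_bounded T K.
Proof.
split=> [/asboolP[Tl Tc]|[K K0 [Tl TK]]].
  pose T' : {linear H -> H} := HB.pack T (GRing.isLinear.Build _ _ _ _ _ Tl).
  have : bounded_near T' (nbhs (0 : H)).
    by apply: continuous_linear_bounded; exact: Tc.
  move=> /linear_boundedP[y [yreal fr]].
  have yE : (complex.Re y)%:C = y by rewrite RRe_real.
  exists (`|complex.Re y| + 1); first by rewrite addr_ge0.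
  split=> // x; rewrite rnorm_le rmorphM/= rnormE.
  by apply: fr; rewrite -yE ltcR (le_lt_trans (ler_norm _))// ltrDl.
apply/asboolP; split=> //.
pose T' : {linear H -> H} := HB.pack T (GRing.isLinear.Build _ _ _ _ _ Tl).
have : bounded_near T' (nbhs (0 : H)).
  apply/linear_boundedP; exists K%:C; split; first by rewrite complex_real.
  move=> r Kr x; rewrite (@le_trans _ _ (K%:C * `|x|))//.
    by rewrite -!rnormE -rmorphM/= lecR.
  by rewrite ler_wpM2r// ltW.
exact: bounded_linear_continuous.
Qed.

Lemma bop_boundedP (T : bounded_operator) :
  exists2 K, 0 <= K & linfun_bounded T K.
Proof. by apply/is_bounded_operatorP; case: T. Qed.

Lemma is_bounded_operator_closed : subsemimod_closed is_bounded_operator.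
Proof.
split; first split.
- apply/is_bounded_operatorP; exists 0 => //; split.
    by move=> a x y; rewrite /= scaler0 addr0.
  by move=> x; rewrite rnorm0 mul0r.
- move=> S T /is_bounded_operatorP[K K0 [Sl SK]].
  move=> /is_bounded_operatorP[L L0 [Tl TL]].
  apply/is_bounded_operatorP; exists (K + L); first exact: addr_ge0.
  split=> [a x y|x]; first by rewrite !fctE Sl Tl scalerDr addrACA.
  by rewrite fctE (le_trans (rnormD _ _))// mulrDl lerD.
- move=> a T /is_bounded_operatorP[K K0 [Tl TK]].
  apply/is_bounded_operatorP; exists (cabs a * K).
    by rewrite mulr_ge0// cabs_ge0.
  split=> [b x y|x]; first by rewrite !fctE Tl scalerDr !scalerA mulrC.
  by rewrite fctE rnormZ -mulrA ler_wpM2l// cabs_ge0.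
Qed.

HB.instance Definition _ := GRing.SubChoice_isSubLmodule.Build R[i] (H -> H)
  is_bounded_operator bounded_operator is_bounded_operator_closed.

Lemma bop_ext (S T : bounded_operator) : (forall x, S x = T x) -> S = T.
Proof. by move=> ST; apply: val_inj; apply/funext. Qed.

Lemma bopD (S T : bounded_operator) x : (S + T) x = S x + T x.
Proof. by []. Qed.

Lemma bopN (S : bounded_operator) x : (- S) x = - S x.
Proof. by []. Qed.

Lemma bopZ a (S : bounded_operator) x : (a *: S) x = a *: S x.
Proof. by []. Qed.

Lemma bop_lin (T : bounded_operator) a x y : T (a *: x + y) = a *: T x + T y.
Proof. by case: T => T /= /asboolP[->]. Qed.

Lemma bop_add (T : bounded_operator) x y : T (x + y) = T x + T y.
Proof. by rewrite -{1}(scale1r x) bop_lin scale1r. Qed.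

Lemma bop0 (T : bounded_operator) : T 0 = 0.
Proof.
by rewrite -[X in T X](addNr 0) -scaleN1r bop_lin scaleN1r addNr.
Qed.

Lemma bop_scale (T : bounded_operator) a x : T (a *: x) = a *: T x.
Proof. by rewrite -[a *: x]addr0 bop_lin bop0 addr0. Qed.

Lemma is_bop_id : is_bounded_operator idfun.
Proof.
by apply/is_bounded_operatorP; exists 1 => //; split=> // x; rewrite mul1r.
Qed.

Lemma is_bop_comp (S T : bounded_operator) : is_bounded_operator (S \o T).
Proof.
have [K K0 [Sl SK]] := bop_boundedP S; have [L L0 [Tl TL]] := bop_boundedP T.
apply/is_bounded_operatorP; exists (K * L); first exact: mulr_ge0.
split=> [a x y|x] /=; first by rewrite Tl Sl.
by rewrite -mulrA (le_trans (SK _))// ler_wpM2l.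
Qed.

Definition bop_one : bounded_operator := BoundedOperator is_bop_id.
Definition bop_mul (S T : bounded_operator) : bounded_operator :=
  BoundedOperator (is_bop_comp S T).

Fact bop_mulA : associative bop_mul.
Proof. by move=> S T U; apply: bop_ext. Qed.
Fact bop_mul1r : left_id bop_one bop_mul.
Proof. by move=> S; apply: bop_ext. Qed.
Fact bop_mulr1 : right_id bop_one bop_mul.
Proof. by move=> S; apply: bop_ext. Qed.
Fact bop_mulDl : left_distributive bop_mul +%R.
Proof. by move=> S T U; apply: bop_ext. Qed.
Fact bop_mulDr : right_distributive bop_mul +%R.
Proof. by move=> S T U; apply: bop_ext => x; rewrite /= bop_add. Qed.

HB.instance Definition _ := GRing.Zmodule_isPzRing.Build bounded_operator
  bop_mulA bop_mul1r bop_mulr1 bop_mulDl bop_mulDr.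

Lemma bopM (S T : bounded_operator) x : (S * T) x = S (T x).
Proof. by []. Qed.

Lemma bop1 x : (1 : bounded_operator) x = x.
Proof. by []. Qed.

Lemma bop_scaleAl a (S T : bounded_operator) : a *: (S * T) = (a *: S) * T.
Proof. by apply: bop_ext. Qed.

Lemma bop_scaleAr a (S T : bounded_operator) : a *: (S * T) = S * (a *: T).
Proof.
by apply: bop_ext => x; rewrite bopZ !bopM bopZ bop_scale.
Qed.

Definition op_norm (T : bounded_operator) : R :=
  sup [set rnorm (T x) | x in [set x | rnorm x <= 1]].

Let has_sup_op (T : bounded_operator) :
  has_sup [set rnorm (T x) | x in [set x | rnorm x <= 1]].
Proof.
have [K K0 [_ TK]] := bop_boundedP T; split.
  by exists (rnorm (T 0)), 0 => //=; rewrite rnorm0.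
exists K => _ [x /= x1 <-]; rewrite (le_trans (TK _))//.
by rewrite -[leRHS]mulr1 ler_wpM2l.
Qed.

Lemma op_norm_ge0 T : 0 <= op_norm T.
Proof.
apply: (@le_trans _ _ (rnorm (T 0))); first exact: rnorm_ge0.
by apply: sup_upper_bound (has_sup_op T) _ _; exists 0 => //=; rewrite rnorm0.
Qed.

Lemma op_normP (T : bounded_operator) x : rnorm (T x) <= op_norm T * rnorm x.
Proof.
have [->|x0] := eqVneq x 0; first by rewrite bop0 rnorm0 mulr0.
have nx : 0 < rnorm x.
  by rewrite lt0r rnorm_ge0 andbT; apply: contra x0 => /eqP/rnorm0_eq0 ->.
have h : rnorm (T ((rnorm x)^-1%:C *: x)) <= op_norm T.
  apply: sup_upper_bound (has_sup_op T) _ _; exists ((rnorm x)^-1%:C *: x) => //=.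
  by rewrite rnormZ cabs_real ?invr_ge0 ?rnorm_ge0// mulVf// gt_eqF.
rewrite bop_scale rnormZ cabs_real ?invr_ge0 ?rnorm_ge0// mulrC in h.
by rewrite ler_pdivrMr in h.
Qed.

Lemma op_norm_le (T : bounded_operator) K : 0 <= K -> (forall x, rnorm (T x) <= K * rnorm x) ->
  op_norm T <= K.
Proof.
move=> K0 TK; apply: ge_sup; first exact: (has_sup_op T).1.
move=> _ [x /= x1 <-]; rewrite (le_trans (TK _))//.
by rewrite -[leRHS]mulr1 ler_wpM2l.
Qed.

Lemma bop_linfun (T : bounded_operator) : linfun_bounded T (op_norm T).
Proof. by split; [exact: bop_lin|exact: op_normP]. Qed.

Lemma op_normD S T : op_norm (S + T) <= op_norm S + op_norm T.
Proof.
apply: op_norm_le; first by rewrite addr_ge0 ?op_norm_ge0.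
by move=> x; rewrite bopD mulrDl (le_trans (rnormD _ _))// lerD ?op_normP.
Qed.

Lemma op_normZ_le a T : op_norm (a *: T) <= cabs a * op_norm T.
Proof.
apply: op_norm_le; first by rewrite mulr_ge0 ?op_norm_ge0 ?cabs_ge0.
by move=> x; rewrite bopZ rnormZ -mulrA ler_wpM2l ?op_normP ?cabs_ge0.
Qed.

Lemma op_normM S T : op_norm (S * T) <= op_norm S * op_norm T.
Proof.
apply: op_norm_le; first by rewrite mulr_ge0 ?op_norm_ge0.
move=> x; rewrite bopM -mulrA (le_trans (op_normP _ _))//.
by rewrite ler_wpM2l ?op_normP ?op_norm_ge0.
Qed.

Lemma op_norm0_eq0 T : op_norm T = 0 -> T = 0.
Proof.
move=> T0; apply: bop_ext => x; apply: rnorm0_eq0; apply/eqP.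
by rewrite eq_le rnorm_ge0 andbT (le_trans (op_normP _ _))// T0 mul0r.
Qed.

Lemma hs0 : hilbert_schmidt (0 : bounded_operator) /\
  hs_norm (0 : bounded_operator) <= 0.
Proof.
apply: hs_norm_le => // e _ n; rewrite expr0n/= big1// => i _.
by rewrite rnorm0 expr0n.
Qed.

Lemma hsD (S T : bounded_operator) : hilbert_schmidt S -> hilbert_schmidt T ->
  hilbert_schmidt (S + T : bounded_operator) /\
  hs_norm (S + T : bounded_operator) <= hs_norm S + hs_norm T.
Proof.
move=> hS hT; apply: hs_norm_le; first by rewrite addr_ge0 ?hs_norm_ge0.
move=> e eb n; apply: (@le_trans _ _
    (\sum_(i < n) (rnorm (S (e i)) + rnorm (T (e i))) ^+ 2)).
  apply: ler_sum => i _; rewrite ler_sqr ?nnegrE ?addr_ge0 ?rnorm_ge0//.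
  by rewrite bopD rnormD.
apply: (@sum_Minkowski _ (fun i => rnorm (S (e i))) (fun i => rnorm (T (e i))));
  by rewrite ?hs_norm_ge0//; exact: hs_normP.
Qed.

Lemma hs_mulr (S T : bounded_operator) : hilbert_schmidt S ->
  hilbert_schmidt (S * T : bounded_operator) /\
  hs_norm (S * T : bounded_operator) <= hs_norm S * op_norm T.
Proof.
move=> hS; apply: hs_norm_le; first by rewrite mulr_ge0 ?hs_norm_ge0 ?op_norm_ge0.
move=> e eb; apply/hs_sum_le.
apply: (@hs_sum_comp _ _ e e S T _ (op_norm S)) => //.
- exact: bop_linfun.
- exact: bop_linfun.
- exact: op_norm_ge0.
- exact: hs_norm_ge0.
- by apply/hs_sum_le => n; exact: hs_normP.
Qed.

Lemma hs_mull (S T : bounded_operator) : hilbert_schmidt T ->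
  hilbert_schmidt (S * T : bounded_operator) /\
  hs_norm (S * T : bounded_operator) <= op_norm S * hs_norm T.
Proof.
move=> hT; apply: hs_norm_le; first by rewrite mulr_ge0 ?hs_norm_ge0 ?op_norm_ge0.
move=> e eb n; apply: (@le_trans _ _
    (\sum_(i < n) op_norm S ^+ 2 * rnorm (T (e i)) ^+ 2)).
  apply: ler_sum => i _; rewrite -exprMn ler_sqr ?nnegrE ?mulr_ge0 ?rnorm_ge0 ?op_norm_ge0//.
  by rewrite bopM op_normP.
by rewrite -mulr_sumr exprMn ler_wpM2l ?sqr_ge0// hs_normP.
Qed.

Lemma hsZ a (T : bounded_operator) : hilbert_schmidt T ->
  hilbert_schmidt (a *: T : bounded_operator) /\
  hs_norm (a *: T : bounded_operator) <= cabs a * hs_norm T.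
Proof.
move=> hT; apply: hs_norm_le; first by rewrite mulr_ge0 ?hs_norm_ge0 ?cabs_ge0.
move=> e eb n.
under eq_bigr do rewrite bopZ rnormZ exprMn.
by rewrite -mulr_sumr exprMn ler_wpM2l ?sqr_ge0// hs_normP.
Qed.

End bounded_operators.

Section restricted_algebra.
Context {R : realType} {H : hilbertType R}.
Variable J : bounded_operator H.
Implicit Types S T : bounded_operator H.

Definition commutator T : bounded_operator H := J * T - T * J.

Definition is_restricted : pred (bounded_operator H) :=
  fun T => `[< hilbert_schmidt (commutator T) >].

Record restricted_operator := RestrictedOperator {
  rop_val :> bounded_operator H ;
  _ : is_restricted rop_val
}.

HB.instance Definition _ := [isSub for rop_val].
HB.instance Definition _ := [Choice of restricted_operator by <:].

Lemma commutatorD S T : commutator (S + T) = commutator S + commutator T.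
Proof. by rewrite /commutator mulrDr mulrDl opprD addrACA. Qed.

Lemma commutatorZ a T : commutator (a *: T) = a *: commutator T.
Proof. by rewrite /commutator -bop_scaleAr -bop_scaleAl scalerBr. Qed.

Lemma commutatorM S T :
  commutator (S * T) = commutator S * T + S * commutator T.
Proof.
by rewrite /commutator mulrBl mulrBr !mulrA addrA subrK.
Qed.

Lemma commutator1 : commutator 1 = 0.
Proof. by rewrite /commutator mulr1 mul1r subrr. Qed.

Lemma commutator0 : commutator 0 = 0.
Proof. by rewrite /commutator mulr0 mul0r subrr. Qed.

Lemma rop_hs (T : restricted_operator) : hilbert_schmidt (commutator T).
Proof. by case: T => T /= /asboolP. Qed.

Lemma is_restricted_closed : subsemimod_closed is_restricted.
Proof.
split; first split.
- by apply/asboolP; rewrite commutator0; exact: (hs0 H).1.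
- move=> S T /asboolP hS /asboolP hT; apply/asboolP; rewrite commutatorD.
  exact: (hsD hS hT).1.
- move=> a T /asboolP hT; apply/asboolP; rewrite commutatorZ.
  exact: (hsZ a hT).1.
Qed.

HB.instance Definition _ := GRing.SubChoice_isSubLmodule.Build R[i]
  (bounded_operator H) is_restricted restricted_operator is_restricted_closed.

Lemma is_restricted_subring_closed : subring_closed is_restricted.
Proof.
split.
- by apply/asboolP; rewrite commutator1; exact: (hs0 H).1.
- move=> S T /asboolP hS /asboolP hT; apply/asboolP.
  rewrite commutatorD -scaleN1r commutatorZ; apply: (hsD hS _).1.
  exact: (hsZ _ hT).1.
- move=> S T /asboolP hS /asboolP hT; apply/asboolP; rewrite commutatorM.
  by apply: (hsD _ _).1; [exact: (hs_mulr T hS).1|exact: (hs_mull S hT).1].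
Qed.

HB.instance Definition _ := GRing.SubZmodule_isSubPzRing.Build
  (bounded_operator H) is_restricted restricted_operator
  is_restricted_subring_closed.

Lemma rop_ext (S T : restricted_operator) : (forall x, S x = T x) -> S = T.
Proof. by move=> ST; apply: val_inj; exact: bop_ext. Qed.

Lemma rop_scaleAl a (S T : restricted_operator) : a *: (S * T) = (a *: S) * T.
Proof. by apply: val_inj; exact: bop_scaleAl. Qed.

Lemma rop_scaleAr a (S T : restricted_operator) : a *: (S * T) = S * (a *: T).
Proof. by apply: val_inj; exact: bop_scaleAr. Qed.

Definition restricted_norm (T : restricted_operator) : R :=
  op_norm T + hs_norm (commutator T).

Lemma restricted_norm_ge0 (T : restricted_operator) : 0 <= restricted_norm T.
Proof. by rewrite addr_ge0 ?op_norm_ge0 ?hs_norm_ge0. Qed.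

Lemma restricted_normD (S T : restricted_operator) :
  restricted_norm (S + T) <= restricted_norm S + restricted_norm T.
Proof.
rewrite /restricted_norm addrACA lerD ?op_normD// commutatorD.
by apply: (hsD _ _).2; exact: rop_hs.
Qed.

Lemma restricted_normZ_le a (T : restricted_operator) :
  restricted_norm (a *: T) <= cabs a * restricted_norm T.
Proof.
rewrite /restricted_norm mulrDr lerD ?op_normZ_le// commutatorZ.
by apply: (hsZ _ _).2; exact: rop_hs.
Qed.

Lemma restricted_normM (S T : restricted_operator) :
  restricted_norm (S * T) <= restricted_norm S * restricted_norm T.
Proof.
have hS := rop_hs S; have hT := rop_hs T.
rewrite /restricted_norm commutatorM.
have := op_normM S T.
have := (hsD (hs_mulr T hS).1 (hs_mull S hT).1).2.
have := (hs_mulr T hS).2; have := (hs_mull S hT).2.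
have : 0 <= hs_norm (commutator S) * hs_norm (commutator T).
  by rewrite mulr_ge0 ?hs_norm_ge0.
by lra.
Qed.

Lemma restricted_norm0_eq0 (T : restricted_operator) :
  restricted_norm T = 0 -> T = 0.
Proof.
move=> T0; apply: val_inj; apply: op_norm0_eq0; apply/eqP.
by rewrite eq_le op_norm_ge0 andbT -T0 lerDl hs_norm_ge0.
Qed.

End restricted_algebra.

Section norm_of_real.
Context {R : realType} {V : lmodType R[i]} (N : V -> R).
Hypothesis ND : forall x y, N (x + y) <= N x + N y.
Hypothesis NZ : forall a x, N (a *: x) <= cabs a * N x.

Lemma real_normD x y : (N (x + y))%:C <= (N x)%:C + (N y)%:C :> R[i].
Proof. by rewrite -rmorphD/= lecR. Qed.

Lemma real_normZ a x : (N (a *: x))%:C = `|a| * (N x)%:C :> R[i].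
Proof.
rewrite -cabsE -rmorphM/=; congr (_%:C); apply/eqP; rewrite eq_le NZ/=.
have [->|a0] := eqVneq a 0.
  by rewrite cabs0 mul0r scale0r; have := ND 0 0; rewrite addr0; lra.
have ca : 0 < cabs a.
  by rewrite lt0r cabs_ge0 andbT; apply: contra a0 => /eqP/cabs0_eq0 ->.
have := NZ a^-1 (a *: x); rewrite scalerA mulVf// scale1r.
have -> : cabs a^-1 = (cabs a)^-1.
  by apply: (mulfI (lt0r_neq0 ca)); rewrite -cabsM (mulfV a0) mulfV ?gt_eqF// /cabs normr1.
by rewrite mulrC ler_pdivlMr// mulrC.
Qed.

End norm_of_real.

HB.instance Definition _ (R : realType) (H : hilbertType R)
    (J : bounded_operator H) := Lmodule_isNormed.Build R[i]
  (restricted_operator J)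
  (real_normD (@restricted_normD R H J))
  (real_normZ (@restricted_normD R H J) (@restricted_normZ_le R H J))
  (fun T T0 => restricted_norm0_eq0 (complexI T0)).

Section completeness_tools.
Context {R : realType} {V : normedModType R[i]}.

Lemma rnorm_cauchyP (F : set_system V) {FF : ProperFilter F} :
  cauchy F <-> forall e : R, 0 < e -> exists x, F [set y | rnorm (x - y) < e].
Proof.
split=> [/cauchyP Fc e e0|h].
  have /Fc[x] : 0 < e%:C by rewrite ltcR.
  rewrite -ball_normE => Fx; exists x; apply: filterS Fx => y /=.
  by rewrite rnorm_lt.
apply/cauchyP => e e0.
have eE : (complex.Re e)%:C = e by rewrite RRe_real// gtr0_real.
have /h[x Fx] : 0 < complex.Re e by rewrite -ltcR eE.
by exists x; rewrite -ball_normE; apply: filterS Fx => y /=; rewrite rnorm_lt eE.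
Qed.

Lemma rnorm_cvgP T (F : set_system T) {FF : Filter F} (f : T -> V) (l : V) :
  f @ F --> l <-> forall e : R, 0 < e -> \forall t \near F, rnorm (l - f t) < e.
Proof.
split=> [/cvgrPdist_lt Fc e e0|h].
  have /Fc : 0 < e%:C by rewrite ltcR.
  by apply: filterS => t; rewrite rnorm_lt.
apply/cvgrPdist_lt => e e0.
have eE : (complex.Re e)%:C = e by rewrite RRe_real// gtr0_real.
have /h : 0 < complex.Re e by rewrite -ltcR eE.
by apply: filterS => t; rewrite rnorm_lt eE.
Qed.

Lemma rnorm_dist (x y : V) : `|rnorm x - rnorm y| <= rnorm (x - y).
Proof.
have h (u v : V) : rnorm u - rnorm v <= rnorm (u - v).
  by rewrite lerBlDr -{1}(subrK v u) rnormD.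
by rewrite ler_norml h lerNl opprB rnorm_distC h.
Qed.

Lemma cvg_rnorm T (F : set_system T) {FF : Filter F} (f : T -> V) (l : V) :
  f @ F --> l -> (fun t => rnorm (f t)) @ F --> rnorm l.
Proof.
move=> /rnorm_cvgP h; apply/cvgrPdist_lt => e /h.
by apply: filterS => t; apply: le_lt_trans; exact: rnorm_dist.
Qed.

Lemma cvg_sumsq T (F : set_system T) {FF : Filter F} (f : nat -> T -> V)
    (l : nat -> V) n : (forall i, f i @ F --> l i) ->
  (fun t => \sum_(i < n) rnorm (f i t) ^+ 2) @ F -->
  \sum_(i < n) rnorm (l i) ^+ 2.
Proof.
move=> fl; elim: n => [|n ih].
  rewrite big_ord0; under eq_fun do rewrite big_ord0; exact: cvg_cst.
rewrite big_ord_recr/=; under eq_fun do rewrite big_ord_recr/=.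
apply: cvgD ih _; under eq_fun do rewrite expr2.
by rewrite expr2; apply: cvgM; exact: cvg_rnorm.
Qed.

End completeness_tools.

Section complete_restricted.
Context {R : realType} {H : hilbertType R} (J : bounded_operator H).
Notation B := (restricted_operator J).

Lemma rop_rnormE (T : B) : rnorm T = restricted_norm T.
Proof. by []. Qed.

Lemma op_norm_rnorm (T : B) : op_norm T <= rnorm T.
Proof. by rewrite rop_rnormE lerDl hs_norm_ge0. Qed.

Lemma rop_rnorm_le (T : B) x : rnorm (T x) <= rnorm T * rnorm x.
Proof.
rewrite (le_trans (op_normP _ _))// ler_wpM2r ?rnorm_ge0//.
exact: op_norm_rnorm.
Qed.

Lemma bop_cvg (S : bounded_operator H) T (F : set_system T) {FF : Filter F}
  (f : T -> H) l : f @ F --> l -> (fun t => S (f t)) @ F --> S l.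
Proof.
move=> fl; have /asboolP[_ Sc] : is_bounded_operator S by case: S.
by apply: continuous_cvg => //; exact: Sc.
Qed.

Lemma restricted_complete (F : set_system B) :
  ProperFilter F -> cauchy F -> cvg F.
Proof.
move=> FF /rnorm_cauchyP Fc.
have /choice[L FL] : forall x : H, exists l : H, (fun T : B => T x) @ F --> l.
  move=> x; apply/cvg_ex; apply: cauchy_cvg; apply/rnorm_cauchyP => e e0.
  have x1 : 0 < rnorm x + 1 by rewrite ltr_wpDl ?rnorm_ge0.
  have [|T FT] := Fc (e / (rnorm x + 1)); first by rewrite divr_gt0.
  exists (T x); suff : F [set S : B | rnorm (T x - S x) < e] by [].
  apply: filterS FT => S /= TS.
  rewrite -[T x - S x]/((T - S) x) (le_lt_trans (rop_rnorm_le _ _))//.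
  rewrite ltr_pdivlMr// in TS; rewrite (le_lt_trans _ TS)//.
  by rewrite ler_wpM2l ?rnorm_ge0// lerDl.
have Ll a x y : L (a *: x + y) = a *: L x + L y.
  apply: (@cvg_unique _ (@norm_hausdorff _ H)  _ _ _ _ (FL _)).
  rewrite (_ : (fun T : B => T (a *: x + y)) = (fun T : B => a *: T x + T y)).
    by apply: cvgD; [apply: cvgZl_tmp|]; exact: FL.
  by apply/funext => T; exact: bop_lin.
have LK e (T0 : B) x : F [set T | rnorm (T0 - T) < e] ->
    rnorm (L x - T0 x) <= e * rnorm x.
  move=> FT0; have : (fun T : B => rnorm (T x - T0 x)) @ F --> rnorm (L x - T0 x).
    by apply: cvg_rnorm; apply: cvgB => //; exact: cvg_cst.
  move/cvgr_to_le; apply; apply: filterS FT0 => T /= TT0.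
  rewrite rnorm_distC -[_ - _]/((T0 - T) x) (le_trans (rop_rnorm_le _ _))//.
  by rewrite ler_wpM2r ?rnorm_ge0// ltW.
have Lb : is_bounded_operator L.
  have [//|T0 FT0] := Fc 1.
  apply/is_bounded_operatorP; exists (1 + rnorm T0).
    by rewrite addr_ge0// rnorm_ge0.
  split=> // x; rewrite -[L x](subrK (T0 x)) (le_trans (rnormD _ _))//.
  by rewrite mulrDl lerD// ?rop_rnorm_le//; exact: LK.
pose L' : bounded_operator H := BoundedOperator Lb.
have key e (T0 : B) : 0 < e -> F [set T | rnorm (T0 - T) < e] ->
    hilbert_schmidt (commutator J (L' - T0)) /\
    hs_norm (commutator J (L' - T0)) <= e.
  move=> e0 FT0; apply: hs_norm_le; first exact: ltW.
  move=> eb ebP n.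
  have : (fun T : B => \sum_(i < n) rnorm (commutator J (T - T0) (eb i)) ^+ 2)
      @ F --> \sum_(i < n) rnorm (commutator J (L' - T0) (eb i)) ^+ 2.
    apply: (@cvg_sumsq _ _ _ _ _
      (fun i (T : B) => commutator J (T - T0) (eb i))
      (fun i => commutator J (L' - T0) (eb i))) => i.
    rewrite -[commutator J (L' - T0) (eb i)]/(J (L (eb i) - T0 (eb i)) -
      (L (J (eb i)) - T0 (J (eb i)))).
    rewrite -[X in X @ F]/(fun T : B => J (T (eb i) - T0 (eb i)) -
      (T (J (eb i)) - T0 (J (eb i)))).
    apply: cvgB; last by apply: cvgB => //; exact: cvg_cst.
    by apply: bop_cvg; apply: cvgB => //; exact: cvg_cst.
  move/cvgr_to_le; apply; apply: filterS FT0 => T TT0.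
  apply: (@le_trans _ _ (rnorm (T - T0) ^+ 2)); last first.
    by rewrite ler_sqr ?nnegrE ?rnorm_ge0 ?ltW// rnorm_distC.
  apply: (@le_trans _ _ (hs_norm (commutator J (T - T0)) ^+ 2)).
    by apply: hs_normP => //; exact: rop_hs.
  by rewrite ler_sqr ?nnegrE ?rnorm_ge0 ?hs_norm_ge0// lerDr op_norm_ge0.
have Lr : is_restricted J L'.
  have [//|T0 FT0] := Fc 1; apply/asboolP.
  rewrite -[L'](subrK (rop_val T0)) commutatorD.
  by apply: (hsD _ _).1; [exact: (key _ _ _ FT0).1|exact: rop_hs].
pose L2 : B := RestrictedOperator Lr.
apply/cvg_ex; exists L2; apply/rnorm_cvgP => e e0.
have e3 : 0 < e / 4 by rewrite divr_gt0.
have [T0 FT0] := Fc _ e3.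
have LT0 : rnorm (L2 - T0) <= e / 4 + e / 4.
  rewrite rop_rnormE lerD//; last exact: (key _ _ e3 FT0).2.
  by apply: op_norm_le => [|x]; [exact: ltW|exact: LK].
apply: filterS FT0 => T /= TT0.
have -> : L2 - T = (L2 - T0) + (T0 - T) by rewrite addrA subrK.
rewrite (le_lt_trans (rnormD _ _))//.
by move: LT0 TT0 e0; set u := rnorm _; set v := rnorm _; lra.
Qed.

End complete_restricted.

HB.instance Definition _ (R : realType) (H : hilbertType R)
    (J : bounded_operator H) := Uniform_isComplete.Build
  (restricted_operator J) (@restricted_complete R H J).

Section restricted_mul.
Context {R : realType} {H : hilbertType R} {J : bounded_operator H}.

Lemma restricted_mul_continuous (Y : topologicalType)
    (f g : Y -> restricted_operator J) :
  continuous f -> continuous g -> continuous (fun y => f y * g y).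
Proof.
move=> fc gc y; apply/rnorm_cvgP => e e0.
pose K := rnorm (f y) + rnorm (g y) + 1.
have K1 : 1 <= K by rewrite lerDr addr_ge0// rnorm_ge0.
have K0 : 0 < K by rewrite (lt_le_trans _ K1).
pose d := Num.min 1 (e / (2 * K)).
have d0 : 0 < d by rewrite lt_min ltr01 divr_gt0// mulr_gt0.
have d1 : d <= 1 by rewrite ge_min lexx.
have dK : 2 * d * K <= e.
  by rewrite mulrAC -ler_pdivlMl ?mulr_gt0// mulrC ge_min lexx orbT.
have /rnorm_cvgP/(_ _ d0) hf := fc y; have /rnorm_cvgP/(_ _ d0) hg := gc y.
apply: filterS2 hf hg => t hf hg.
have -> : f y * g y - f t * g t = (f y - f t) * g y + f t * (g y - g t).
  by rewrite mulrBl mulrBr addrA subrK.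
rewrite (le_lt_trans (rnormD _ _))//.
have h1 := restricted_normM (f y - f t) (g y).
have h2 := restricted_normM (f t) (g y - g t).
have ft : rnorm (f t) <= rnorm (f y) + d.
  have -> : f t = f y - (f y - f t) by rewrite opprB addrC subrK.
  by rewrite (le_trans (rnormB _ _))// lerD2l ltW.
move: h1 h2; rewrite -!rop_rnormE => h1 h2.
rewrite (le_lt_trans (lerD h1 h2))//.
have p1 : rnorm (f y - f t) * rnorm (g y) <= d * rnorm (g y).
  by rewrite ler_wpM2r ?rnorm_ge0// ltW.
have p2 : rnorm (f t) * rnorm (g y - g t) <= (rnorm (f y) + 1) * d.
  by rewrite ler_pM ?rnorm_ge0 ?(ltW hg)// (le_trans ft)// lerD2l.
rewrite (le_lt_trans (lerD p1 p2))//.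
have -> : d * rnorm (g y) + (rnorm (f y) + 1) * d = d * K by rewrite /K; ring.
rewrite (lt_le_trans _ dK)// -mulrA ltr_pMl ?mulr_gt0//.
by rewrite ltr1n.
Qed.

End restricted_mul.

Section continuous_functions.
Context {R : realType}.
Variables (Y : compactMetricType R) (V : completeNormedModType R[i]).

Definition is_continuous : pred (Y -> V) := fun f => `[< continuous f >].

Record cfun := CFun {
  cfun_val :> Y -> V ;
  _ : is_continuous cfun_val
}.

HB.instance Definition _ := [isSub for cfun_val].
HB.instance Definition _ := [Choice of cfun by <:].

Lemma cfun_continuous (f : cfun) : continuous f.
Proof. by case: f => f /= /asboolP. Qed.

Lemma cfun_ext (f g : cfun) : (forall y, f y = g y) -> f = g.
Proof. by move=> fg; apply: val_inj; apply/funext. Qed.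

Lemma is_continuous_closed : subsemimod_closed is_continuous.
Proof.
split; first split.
- by apply/asboolP => y; exact: cvg_cst.
- by move=> f g /asboolP fc /asboolP gc; apply/asboolP => y; apply: cvgD;
     [exact: fc|exact: gc].
- by move=> a f /asboolP fc; apply/asboolP => y; apply: cvgZl_tmp; exact: fc.
Qed.

HB.instance Definition _ := GRing.SubChoice_isSubLmodule.Build R[i] (Y -> V)
  is_continuous cfun is_continuous_closed.

(* When Y is empty this is the supremum of the empty set, which is 0. *)
Definition sup_norm (f : cfun) : R := sup [set rnorm (f y) | y in [set: Y]].

Lemma cfun_bounded (f : cfun) : exists M, forall y, rnorm (f y) <= M.
Proof.
have cf : continuous (fun y => rnorm (f y) : R).
  by move=> y; apply: cvg_rnorm; exact: cfun_continuous.
have : compact ((fun y => rnorm (f y) : R) @` [set: Y]).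
  apply: continuous_compact; last exact: compact_setT.
  exact: continuous_subspaceT.
move=> /compact_bounded[M [Mreal HM]].
have M1 : M < M + 1 by rewrite ltrDl.
exists (M + 1) => y; rewrite -(ger0_norm (rnorm_ge0 (f y))).
by apply: (HM _ M1); exists y.
Qed.

Lemma sup_normP (f : cfun) y : rnorm (f y) <= sup_norm f.
Proof.
have [M hM] := cfun_bounded f; apply: sup_upper_bound; last by exists y.
split; first by exists (rnorm (f y)), y.
by exists M => _ [z _ <-].
Qed.

Lemma sup_norm_le (f : cfun) M : 0 <= M -> (forall y, rnorm (f y) <= M) ->
  sup_norm f <= M.
Proof.
move=> M0 fM; rewrite /sup_norm.
have [->|/set0P ne] := eqVneq [set rnorm (f y) | y in [set: Y]] set0.
  by rewrite sup0.
by apply: ge_sup => // _ [y _ <-].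
Qed.

Lemma sup_norm_ge0 (f : cfun) : 0 <= sup_norm f.
Proof.
rewrite /sup_norm.
have [->|/set0P[_ [y _ _]]] := eqVneq [set rnorm (f y) | y in [set: Y]] set0.
  by rewrite sup0.
by rewrite (le_trans (rnorm_ge0 (f y)))// sup_normP.
Qed.

Lemma sup_normD f g : sup_norm (f + g) <= sup_norm f + sup_norm g.
Proof.
apply: sup_norm_le; first by rewrite addr_ge0 ?sup_norm_ge0.
move=> y; rewrite -[(f + g) y]/(f y + g y) (le_trans (rnormD _ _))//.
by rewrite lerD ?sup_normP.
Qed.

Lemma sup_normZ_le a f : sup_norm (a *: f) <= cabs a * sup_norm f.
Proof.
apply: sup_norm_le; first by rewrite mulr_ge0 ?sup_norm_ge0 ?cabs_ge0.
move=> y; rewrite -[(a *: f) y]/(a *: f y) rnormZ.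
by rewrite ler_wpM2l ?sup_normP ?cabs_ge0.
Qed.

Lemma sup_norm0_eq0 f : sup_norm f = 0 -> f = 0.
Proof.
move=> f0; apply: cfun_ext => y; apply: rnorm0_eq0; apply/eqP.
by rewrite eq_le rnorm_ge0 andbT -f0 sup_normP.
Qed.

HB.instance Definition _ := Lmodule_isNormed.Build R[i] cfun
  (real_normD sup_normD) (real_normZ sup_normD sup_normZ_le)
  (fun f f0 => sup_norm0_eq0 (complexI f0)).

Lemma cfun_rnormE (f : cfun) : rnorm f = sup_norm f.
Proof. by []. Qed.

Lemma cfun_complete (F : set_system cfun) :
  ProperFilter F -> cauchy F -> cvg F.
Proof.
move=> FF /rnorm_cauchyP Fc.
have /choice[g Fg] : forall y : Y, exists l : V, (fun f : cfun => f y) @ F --> l.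
  move=> y; apply/cvg_ex; apply: cauchy_cvg; apply/rnorm_cauchyP => e e0.
  have [//|f Ff] := Fc e.
  exists (f y); suff : F [set h : cfun | rnorm (f y - h y) < e] by [].
  apply: filterS Ff => h /= fh.
  by rewrite (le_lt_trans _ fh)// (sup_normP (f - h)).
have gle e (f : cfun) y : F [set h | rnorm (f - h) < e] -> rnorm (g y - f y) <= e.
  move=> Ff; have : (fun h : cfun => rnorm (h y - f y)) @ F --> rnorm (g y - f y).
    by apply: cvg_rnorm; apply: cvgB => //; exact: cvg_cst.
  move/cvgr_to_le; apply; apply: filterS Ff => h /= fh.
  by rewrite rnorm_distC (le_trans _ (ltW fh))// (sup_normP (f - h)).
have gc : is_continuous g.
  apply/asboolP => y; apply/rnorm_cvgP => e e0.
  have e3 : 0 < e / 4 by rewrite divr_gt0.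
  have [f Ff] := Fc _ e3.
  have /rnorm_cvgP/(_ _ e3) := @cfun_continuous f y; apply: filterS => t.
  have := gle _ _ t Ff; have := gle _ _ y Ff; rewrite (rnorm_distC (g t)).
  have -> : g y - g t = (g y - f y) + (f y - f t) + (f t - g t).
    by rewrite !addrA !subrK.
  move=> h1 h2 h3; rewrite (le_lt_trans (rnormD _ _))//.
  have := rnormD (g y - f y) (f y - f t).
  by move: h1 h2 h3 e0; lra.
apply/cvg_ex; exists (CFun gc : cfun); apply/rnorm_cvgP => e e0.
have e3 : 0 < e / 4 by rewrite divr_gt0.
have [f Ff] := Fc _ e3.
have gf : rnorm ((CFun gc : cfun) - f) <= e / 4.
  by rewrite cfun_rnormE; apply: sup_norm_le => [|y]; [exact: ltW|exact: gle].
apply: filterS Ff => h /= fh.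
have -> : (CFun gc : cfun) - h = ((CFun gc : cfun) - f) + (f - h).
  by rewrite addrA subrK.
rewrite (le_lt_trans (rnormD _ _))//.
by move: gf fh e0; lra.
Qed.

HB.instance Definition _ := Uniform_isComplete.Build cfun cfun_complete.

End continuous_functions.

Section restricted_functions.
Context {R : realType} (Y : compactMetricType R).
Context {H : hilbertType R} (J : bounded_operator H).

Lemma is_continuous_subring_closed :
  subring_closed (@is_continuous R Y (restricted_operator J)).
Proof.
split.
- by apply/asboolP => y; exact: cvg_cst.
- move=> f g /asboolP fc /asboolP gc; apply/asboolP => y; apply: cvgB;
     [exact: fc|exact: gc].
- move=> f g /asboolP fc /asboolP gc; apply/asboolP.
  exact: restricted_mul_continuous.
Qed.

HB.instance Definition _ := GRing.SubZmodule_isSubPzRing.Build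
  (Y -> restricted_operator J) (@is_continuous R Y (restricted_operator J))
  (cfun Y (restricted_operator J)) is_continuous_subring_closed.

Lemma sup_normM (f g : cfun Y (restricted_operator J)) :
  sup_norm (f * g) <= sup_norm f * sup_norm g.
Proof.
apply: sup_norm_le; first by rewrite mulr_ge0 ?sup_norm_ge0.
move=> y; rewrite -[(f * g) y]/(f y * g y) (le_trans (restricted_normM _ _))//.
by rewrite ler_pM ?restricted_norm_ge0// -rop_rnormE sup_normP.
Qed.

Lemma cfun_scaleAl a (f g : cfun Y (restricted_operator J)) :
  a *: (f * g) = (a *: f) * g.
Proof. by apply: cfun_ext => y; exact: rop_scaleAl. Qed.

Lemma cfun_scaleAr a (f g : cfun Y (restricted_operator J)) :
  a *: (f * g) = f * (a *: g).
Proof. by apply: cfun_ext => y; exact: rop_scaleAr. Qed.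

Lemma cfun_normM (f g : cfun Y (restricted_operator J)) :
  `|f * g| <= `|f| * `|g|.
Proof. by rewrite -!rnormE -rmorphM/= lecR sup_normM. Qed.

End restricted_functions.

Section algebra_sets.
Variable A : pzRingType.

Definition idempotents : set A := [set q | q * q = q].

(* A need not be a nontrivial ring, hence no use of GRing.unit. *)
Definition mutually_inverse (g h : A) := g * h = 1 /\ h * g = 1.

Definition similarity_class (p : A) : set A :=
  [set q | exists g h, mutually_inverse g h /\ q = g * p * h].

End algebra_sets.

Section submanifolds.
Context {R : realType} {V : completeNormedModType R[i]}.
Implicit Types (M N U W D E F G : set V) (phi psi : V -> V).

(* differentiable is Frechet differentiability over the field R[i]. *)
Definition holomorphic_on U phi := forall x, U x -> differentiable phi x.

Definition biholomorphism U W phi psi :=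
  [/\ open U, open W, holomorphic_on U phi & holomorphic_on W psi] /\
  [/\ forall x, U x -> W (phi x), forall y, W y -> U (psi y),
      forall x, U x -> psi (phi x) = x & forall y, W y -> phi (psi y) = y].

Definition closed_subspace E :=
  [/\ E 0, forall (a : R[i]) x y, E x -> E y -> E (a *: x + y) & closed E].

Definition complemented_in E G :=
  [/\ closed_subspace E, closed_subspace G, E `<=` G &
    exists F, [/\ closed_subspace F, F `<=` G, E `&` F = [set 0] &
      forall z, G z -> exists x y, [/\ E x, F y & z = x + y]]].

Definition flattens U phi M E := forall z, U z -> (M z <-> E (phi z)).

(* The model space at x is the Banach space E, a closed subspace of V. It may
   depend on x. *)
Definition holomorphic_submanifold M :=
  forall x, M x -> exists U W phi psi E,
    [/\ U x, biholomorphism U W phi psi, complemented_in E setT &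
        flattens U phi M E].

(* N is a submanifold of the submanifold M of V: around every point of N some
   chart of V adapted to M also straightens N inside the model space of M. *)
Definition holomorphic_submanifold_of N M :=
  N `<=` M /\
  forall x, N x -> exists U W phi psi D E,
    [/\ U x, biholomorphism U W phi psi, complemented_in E setT &
        complemented_in D E] /\
    flattens U phi M E /\ flattens U phi N D.

End submanifolds.

Definition unitary_operator (R : realType) (H : hilbertType R)
    (J : bounded_operator H) :=
  (forall x y, hdot (J x) (J y) = hdot x y) /\ (forall y, exists x, J x = y).

(* Main.v *)
Require Import Defs.
From HB Require Import structures.
From mathcomp Require Import all_boot all_order all_algebra.
From mathcomp Require Import all_classical all_reals all_analysis.
From mathcomp Require Import complex.
From mathcomp Require Import ring lra.
Set Implicit Arguments. Unset Strict Implicit. Unset Printing Implicit Defensive.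
Import Order.TTheory GRing.Theory Num.Theory.
Import numFieldNormedType.Exports.
Local Open Scope classical_set_scope.
Local Open Scope ring_scope.

(** The statement holds in every complex Banach algebra A, because the idempotents
near a given idempotent p have explicit rational coordinates that extend to
rational coordinates of A itself; no implicit function theorem is involved.

For x in A put g = x p + (1 - x) (1 - p). At x = p this is 1, so it is invertible
near p. If x is idempotent then x g = x p = g p, so x = g p g^-1. The conjugator g
is unique up to a factor commuting with p, and dividing by its block-diagonal
part D = p g p + (1 - p) g (1 - p) yields v = g D^-1 of the form 1 + e with e
off-diagonal with respect to p. Thus e parametrizes the idempotents near p by
e |-> (1 + e) p (1 + e)^-1.

To obtain a chart of A, this is completed by the defect d = v^-1 x - p v^-1,
which vanishes exactly when x = v p v^-1, that is, exactly when x is idempotent.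
For every x it commutes with p (comm_chart_diag). Hence the sum e + d determines
e and d, and x = v (p v^-1 + d) is recovered from it. Both x |-> e + d and the
map back are built from products and inverses, they are mutually inverse between
the explicit sets where the inverses exist (chartK, chart_invK), and idempotents
correspond to the off-diagonal subspace d = 0 (chart_idempotents).

Analysis is needed for two facts only: the invertible elements of a Banach
algebra form an open set, and inversion is holomorphic there. Both come from the
Neumann series (nbhs_invertible, differentiable_inverse).

Finally, every idempotent in the domain of the chart at p is a conjugate of p
(chart_dom_similar). So similarity classes are open in the set of idempotents,
hence also closed, as the complement of a class is a union of classes; and in
each chart domain a class coincides with the whole set of idempotents. *)

(** * Conjugation of idempotents in a ring *)

Section invertible_elements.
Context {A : pzRingType}.
Implicit Types x y : A.

Definition invertible : set A := [set x | exists y, mutually_inverse x y].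

(** The value 0 at a non-invertible element makes inversion a total function, to
which differentiability applies; its values at invertible elements are
the ones that matter. *)
Definition inverse x : A := xget 0 [set y | mutually_inverse x y].

Lemma inverseP x : invertible x -> mutually_inverse x (inverse x).
Proof. by move=> [y xy]; rewrite /inverse; case: xgetP => [z -> //|/(_ y)]. Qed.

Lemma mul_inverse x : invertible x -> x * inverse x = 1.
Proof. by move=> /inverseP[]. Qed.

Lemma inverse_mul x : invertible x -> inverse x * x = 1.
Proof. by move=> /inverseP[]. Qed.

Lemma inverse_uniq x y : mutually_inverse x y -> inverse x = y.
Proof.
move=> [xy yx]; have xi : invertible x by exists y.
by rewrite -[LHS]mulr1 -xy mulrA inverse_mul ?mul1r.
Qed.

Lemma mutually_inverseM x1 y1 x2 y2 : mutually_inverse x1 y1 ->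
  mutually_inverse x2 y2 -> mutually_inverse (x1 * x2) (y2 * y1).
Proof.
move=> [a b] [c d]; split.
  by rewrite mulrA -(mulrA x1) c mulr1.
by rewrite mulrA -(mulrA y2) b mulr1.
Qed.

Lemma mutually_inverse_inverse x :
  invertible x -> mutually_inverse (inverse x) x.
Proof. by move=> /inverseP[]. Qed.

Lemma mutually_inverse1 : mutually_inverse (1 : A) 1.
Proof. by split; rewrite mulr1. Qed.

Lemma comm_inverse x y : invertible x -> GRing.comm y x ->
  GRing.comm y (inverse x).
Proof.
move=> xi yx; rewrite /GRing.comm -[LHS]mul1r -(inverse_mul xi) -mulrA.
by rewrite [x * _]mulrA -yx -[y * x * _]mulrA mul_inverse ?mulr1.
Qed.

End invertible_elements.

Section similarity.
Context {A : pzRingType}.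
Implicit Types p q : A.

Lemma similarity_class_idempotent p :
  idempotents p -> similarity_class p `<=` @idempotents A.
Proof.
move=> pp _ [g [h [[_ hg] ->]]]; rewrite /idempotents/=.
by rewrite !mulrA -(mulrA _ h) hg mulr1 -(mulrA g) pp.
Qed.

Lemma similarity_class_sym p q : similarity_class p q -> similarity_class q p.
Proof.
move=> [g [h [[gh hg] ->]]]; exists h, g; split=> //.
by rewrite !mulrA hg mul1r -mulrA hg mulr1.
Qed.

Lemma similarity_class_trans p q r :
  similarity_class p q -> similarity_class q r -> similarity_class p r.
Proof.
move=> [g [h [gh ->]]] [k [l [kl ->]]]; exists (k * g), (h * l); split.
  exact: mutually_inverseM.
by rewrite !mulrA.
Qed.

End similarity.

(** * Rational coordinates around an idempotent *)

Section chart.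
Context {A : pzRingType}.
Variable p : A.
Hypothesis pp : idempotents p.
Implicit Types x y z : A.

Let pC : p * (1 - p) = 0.
Proof. by rewrite mulrBr mulr1 pp subrr. Qed.
Let Cp : (1 - p) * p = 0.
Proof. by rewrite mulrBl mul1r pp subrr. Qed.
Let CC : (1 - p) * (1 - p) = 1 - p.
Proof. by rewrite {1}mulrBl mul1r pC subr0. Qed.

(** An element x is a two by two matrix of blocks relative to p and 1 - p. *)
Definition diag x := p * x * p + (1 - p) * x * (1 - p).
Definition offdiag x := x - diag x.
Definition reflection := p - (1 - p).

(** This is x p + (1 - x) (1 - p), which equals 1 at x = p and intertwines x with
p when x is idempotent. Writing it as an affine function of x that involves
only multiplication by the involution 2 p - 1 allows x to be recovered from
it. *)
Definition intertwiner x := 1 - p + x * reflection.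

Let sp : reflection * p = p.
Proof. by rewrite mulrBl pp Cp subr0. Qed.
Let sC : reflection * (1 - p) = - (1 - p).
Proof. by rewrite mulrBl pC CC sub0r. Qed.
Let Cs : (1 - p) * reflection = - (1 - p).
Proof. by rewrite mulrBr Cp CC sub0r. Qed.
Let ss : reflection * reflection = 1.
Proof. by rewrite mulrBr sp sC opprK addrC subrK. Qed.

Lemma diagB x y : diag (x - y) = diag x - diag y.
Proof.
by rewrite /diag; move: (1 - p) => q; rewrite !(mulrBr, mulrBl) opprD addrACA.
Qed.

Lemma diag0 : diag 0 = 0.
Proof. by rewrite /diag !mulr0 !mul0r addr0. Qed.

Lemma comm_diag x : GRing.comm p (diag x).
Proof.
rewrite /GRing.comm /diag; move: (1 - p) pC Cp => q pq qp.
rewrite mulrDr mulrDl !mulrA pq !mul0r addr0 pp.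
by rewrite -!mulrA qp !mulr0 addr0 pp.
Qed.

Lemma diagMr x y : GRing.comm p y -> diag (x * y) = diag x * y.
Proof.
move=> py; have Cy : GRing.comm (1 - p) y.
  by apply/commr_sym/commrB; [exact: commr1|exact/commr_sym].
rewrite /diag; move: (1 - p) Cy => q qy.
by rewrite mulrDl -!mulrA -py -qy.
Qed.

Lemma diag1 : diag 1 = 1.
Proof. by rewrite /diag !mulr1 pp CC addrC subrK. Qed.

Lemma diag_id y : GRing.comm p y -> diag y = y.
Proof. by move=> py; rewrite -[y in LHS]mul1r diagMr// diag1 mul1r. Qed.

Lemma diag_offdiag x : diag (offdiag x) = 0.
Proof. by rewrite diagB (diag_id (comm_diag x)) subrr. Qed.

Lemma comm_reflection : GRing.comm p reflection.
Proof. by rewrite /GRing.comm sp mulrBr pC subr0 pp. Qed.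

Lemma intertwiner_p x : intertwiner x * p = x * p.
Proof. by rewrite mulrDl Cp add0r -mulrA sp. Qed.

Lemma intertwiner_idempotent x : idempotents x -> x * intertwiner x = x * p.
Proof.
by move=> xx; rewrite mulrDr mulrA xx -mulrDr addrC subrK.
Qed.

Lemma intertwiner_id : intertwiner p = 1.
Proof. by rewrite /intertwiner comm_reflection sp subrK. Qed.

Lemma intertwinerK x : (intertwiner x - (1 - p)) * reflection = x.
Proof. by rewrite addrC addKr -mulrA ss mulr1. Qed.

(** Dividing by the diagonal part normalizes the intertwiner without spoiling
x g = g p, since diagonal elements commute with p: the frame has diagonal part
1, so that its off-diagonal part is a free coordinate. *)
Definition frame x := intertwiner x * inverse (diag (intertwiner x)).
Definition coframe x := diag (intertwiner x) * inverse (intertwiner x).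

(** The first summand is off-diagonal and carries the coordinates of an
idempotent. The second one is the defect of the frame as a conjugator of p into
x; it turns out to be diagonal, so the two summands do not mix. *)
Definition chart x := frame x - 1 + (coframe x * x - p * coframe x).

(** With v the frame and d the diagonal part of z, the defining relation
d = v^-1 x - p v^-1 of the second summand of the chart is solved for x. *)
Definition chart_inv z :=
  let v := 1 + offdiag z in v * (p * inverse v + diag z).

Definition chart_dom : set A :=
  [set x | invertible (intertwiner x) /\ invertible (diag (intertwiner x))].

(** Once 1 + offdiag z is invertible, the second condition places chart_inv z in
the domain of the chart. *)
Definition chart_codom : set A :=
  [set z | invertible (1 + offdiag z) /\
           invertible (diag (intertwiner (chart_inv z)))].

Section chart_domain.
Variable x : A.
Hypothesis Ux : chart_dom x.
Let gi : invertible (intertwiner x) := Ux.1.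
Let di : invertible (diag (intertwiner x)) := Ux.2.

Lemma frame_coframe : mutually_inverse (frame x) (coframe x).
Proof.
apply: mutually_inverseM; first exact: inverseP.
exact: mutually_inverse_inverse.
Qed.

Lemma coframe_intertwiner : coframe x * intertwiner x = diag (intertwiner x).
Proof. by rewrite -mulrA inverse_mul// mulr1. Qed.

Lemma diag_frame : diag (frame x) = 1.
Proof.
by rewrite diagMr ?mul_inverse//; apply: comm_inverse => //; exact: comm_diag.
Qed.

(** This is what makes the chart work, and it holds for every x of the domain,
idempotent or not. With g the intertwiner, D its diagonal part, w = D g^-1 and
s = 2 p - 1, one has x = (g - (1 - p)) s and w g = D, whence
w x - p w = D s + w (1 - p) - p w: the off-diagonal blocks of w cancel. *)
Lemma comm_chart_diag : GRing.comm p (coframe x * x - p * coframe x).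
Proof.
have -> : coframe x * x =
    (diag (intertwiner x) - coframe x * (1 - p)) * reflection.
  by rewrite -coframe_intertwiner -mulrBr -mulrA intertwinerK.
rewrite mulrBl -[_ * (1 - p) * _]mulrA Cs mulrN opprK -addrA.
apply: commrD.
  by apply: commrM; [exact: comm_diag|exact: comm_reflection].
rewrite /GRing.comm; move: (coframe x) => w.
rewrite [RHS]mulrBl -[w * (1 - p) * p]mulrA Cp mulr0 sub0r.
by rewrite [LHS]mulrBr !mulrA pp mulrBr mulr1 addrAC subrr sub0r.
Qed.

Lemma diag_chart : diag (chart x) = coframe x * x - p * coframe x.
Proof.
have -> : chart x = (coframe x * x - p * coframe x) - (1 - frame x).
  by rewrite /chart opprB addrC.
by rewrite diagB (diag_id comm_chart_diag) diagB diag1 diag_frame subrr subr0.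
Qed.

Lemma offdiag_chart : offdiag (chart x) = frame x - 1.
Proof. by rewrite /offdiag diag_chart addrK. Qed.

Lemma chartK : chart_inv (chart x) = x.
Proof.
rewrite /chart_inv offdiag_chart [1 + _]addrC subrK diag_chart.
rewrite (inverse_uniq frame_coframe) [p * _ + _]addrC subrK mulrA.
by rewrite frame_coframe.1 mul1r.
Qed.

Lemma chart_dom_codom : chart_codom (chart x).
Proof.
split; last by rewrite chartK.
by rewrite offdiag_chart addrC subrK; exists (coframe x); exact: frame_coframe.
Qed.

(** For an idempotent x the relation x g = g p passes to the frame, because the
diagonal part of g commutes with p; hence x is the conjugate of p by the
frame. *)
Lemma coframe_idempotent : idempotents x -> coframe x * x = p * coframe x.
Proof.
move=> xx; have cxf : coframe x * x * frame x = p.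
  rewrite /frame mulrA -[_ * x * intertwiner x]mulrA intertwiner_idempotent//.
  rewrite -intertwiner_p mulrA coframe_intertwiner -comm_diag -mulrA.
  by rewrite mul_inverse// mulr1.
by rewrite -[LHS]mulr1 -frame_coframe.1 mulrA cxf.
Qed.

Lemma chart_idempotents : idempotents x <-> diag (chart x) = 0.
Proof.
rewrite diag_chart; split; first by move=> /coframe_idempotent ->; rewrite subrr.
move=> /subr0_eq cx; apply: (similarity_class_idempotent pp).
exists (frame x), (coframe x); split; first exact: frame_coframe.
by rewrite -mulrA -cx mulrA frame_coframe.1 mul1r.
Qed.

Lemma chart_dom_similar : idempotents x -> similarity_class p x.
Proof.
move=> xx; exists (frame x), (coframe x); split; first exact: frame_coframe.
by rewrite -mulrA -coframe_idempotent// mulrA frame_coframe.1 mul1r.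
Qed.

End chart_domain.

(** The two terms supply the diagonal blocks of w: the first one contains its
(1 - p, 1 - p) block and the second one its (p, p) block, while the unwanted
(p, 1 - p) block occurs in both with opposite signs. *)
Let diag_from_halves w d :
  w * (1 - p) + (p * w + d) * reflection = diag w + d * reflection.
Proof.
rewrite mulrDl addrA; congr (_ + _); rewrite /reflection /diag.
have -> : (1 - p) * w * (1 - p) = w * (1 - p) - p * w * (1 - p).
  by rewrite [(1 - p) * w]mulrBl mul1r mulrBl.
by rewrite mulrBr addrCA.
Qed.

Section chart_codomain.
Variable z : A.
Hypothesis Wz : chart_codom z.
Let v := 1 + offdiag z.
Let vi : invertible v := Wz.1.
Let c := diag (inverse v) + diag z * reflection.

Let comm_c : GRing.comm p c.
Proof.
apply: commrD; first exact: comm_diag.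
by apply: commrM; [exact: comm_diag|exact: comm_reflection].
Qed.

(** The intertwiner of the point with coordinates z splits as v times a diagonal
element, so normalizing it gives back v: the frame is read off correctly. *)
Let intertwiner_chart_inv : intertwiner (chart_inv z) = v * c.
Proof.
have E : 1 - p = v * (inverse v * (1 - p)) by rewrite mulrA mul_inverse// mul1r.
rewrite /intertwiner [in LHS]E /chart_inv -/v -[_ * reflection]mulrA -mulrDr.
by rewrite diag_from_halves.
Qed.

Let diag_intertwiner_chart_inv : diag (intertwiner (chart_inv z)) = c.
Proof.
rewrite intertwiner_chart_inv diagMr//; have -> : v = 1 - (0 - offdiag z).
  by rewrite sub0r opprK.
by rewrite diagB diag1 diagB diag_offdiag subr0 diag0 subr0 mul1r.
Qed.

Lemma chart_codom_dom : chart_dom (chart_inv z).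
Proof.
split; last exact: Wz.2.
have ci : invertible c by rewrite -diag_intertwiner_chart_inv; exact: Wz.2.
rewrite intertwiner_chart_inv; exists (inverse c * inverse v).
by apply: mutually_inverseM; exact: inverseP.
Qed.

Lemma chart_invK : chart (chart_inv z) = z.
Proof.
have ci : invertible c by rewrite -diag_intertwiner_chart_inv; exact: Wz.2.
have fE : frame (chart_inv z) = v.
  rewrite /frame diag_intertwiner_chart_inv intertwiner_chart_inv -mulrA.
  by rewrite mul_inverse// mulr1.
have cE : coframe (chart_inv z) = inverse v.
  symmetry; apply: inverse_uniq; rewrite -fE.
  exact: (frame_coframe chart_codom_dom).
rewrite /chart fE cE /chart_inv -/v mulrA inverse_mul// mul1r [_ + diag z]addrC.
by rewrite addrK /v [1 + _]addrC addrK subrK.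
Qed.

End chart_codomain.

Lemma chart_dom_id : chart_dom p.
Proof.
by split; rewrite intertwiner_id ?diag1; exists 1; exact: mutually_inverse1.
Qed.

End chart.

(** * Inversion in a Banach algebra *)

Local Open Scope complex_scope.

(** A quadratic bound on the remainder is what the resolvent identity produces for
inversion, and it replaces explicit little-o computations over the complex
scalars by real inequalities. *)
Lemma differentiable_quadratic_remainder (R : realType)
    (V W : normedModType R[i]) (f : V -> W) (x : V) (L : {linear V -> W})
    (C d : R) : continuous L -> 0 < d ->
  (forall h, rnorm h < d ->
     rnorm (f (h + x) - (f x + L h)) <= C * rnorm h ^+ 2) ->
  differentiable f x.
Proof.
move=> Lc d0 fC.
have rem : f \o shift x = cst (f x) + L +o_ (0 : V) id.
  apply/eqaddoP => eps eps0; pose e := complex.Re eps.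
  have eE : e%:C = eps by rewrite /e RRe_real// gtr0_real.
  have e0 : 0 < e by rewrite -ltcR eE.
  have C0 : 0 < `|C| + 1 by rewrite ltr_wpDl.
  have m0 : 0 < Num.min d (e / (`|C| + 1)) by rewrite lt_min d0 divr_gt0.
  have idc : (id : V -> V) @ (0 : V) --> (0 : V) by exact: cvg_id.
  have /rnorm_cvgP/(_ _ m0) := idc; apply: filterS => h.
  rewrite sub0r rnormN lt_min => /andP[hd he].
  rewrite -eE -rnormE -[X in _ <= _ * X]rnormE -rmorphM/= lecR.
  rewrite !fctE/= (le_trans (fC h hd))// expr2 mulrA ler_wpM2r ?rnorm_ge0//.
  rewrite ltr_pdivlMr// in he; rewrite (le_trans _ (ltW he))// mulrC.
  by rewrite ler_wpM2l ?rnorm_ge0// (le_trans (ler_norm C))// lerDl.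
apply/diff_locallyP.
have dE : 'd f x = L :> (V -> W) by apply: diff_unique.
by rewrite dE.
Qed.

(** The ring operations are fields of the structure and the ring is built from
them: inheriting from both normed groups and rings would clash with the numeric
domains, which are the common descendant of these two structures. The ring may
be trivial, as the functions on the empty space are. *)
HB.mixin Record isBanachAlgebra (R : realType) A
    & CompleteNormedModule R[i] A := {
  bmul : A -> A -> A ;
  bone : A ;
  bmulA : associative bmul ;
  bmul1r : left_id bone bmul ;
  bmulr1 : right_id bone bmul ;
  bmulDl : left_distributive bmul +%R ;
  bmulDr : right_distributive bmul +%R ;
  bmul_scaleAl : forall (a : R[i]) (x y : A), a *: bmul x y = bmul (a *: x) y ;
  bmul_scaleAr : forall (a : R[i]) (x y : A), a *: bmul x y = bmul x (a *: y) ;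
  norm_bmul : forall x y : A, `|bmul x y| <= `|x| * `|y|
}.

#[short(type="banachAlgebraType")]
HB.structure Definition BanachAlgebra (R : realType) :=
  {A of CompleteNormedModule R[i] A & isBanachAlgebra R A}.

HB.instance Definition _ (R : realType) (A : banachAlgebraType R) :=
  GRing.Zmodule_isPzRing.Build (BanachAlgebra.sort A)
  (@bmulA R A) (@bmul1r R A) (@bmulr1 R A) (@bmulDl R A) (@bmulDr R A).

Section banach_algebra.
Context {R : realType} {A : banachAlgebraType R}.
Implicit Types x y u a : A.

Lemma rnormM x y : rnorm (x * y) <= rnorm x * rnorm y.
Proof. by rewrite -lecR rmorphM/= !rnormE norm_bmul. Qed.

Lemma cvg_balgM T (F : set_system T) {FF : Filter F} (f g : T -> A) a b :
  f @ F --> a -> g @ F --> b -> (fun t => f t * g t) @ F --> a * b.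
Proof.
move=> /rnorm_cvgP fa /rnorm_cvgP gb; apply/rnorm_cvgP => e e0.
pose K := 1 + rnorm a + rnorm b.
have K0 : 0 < K by have := rnorm_ge0 a; have := rnorm_ge0 b; rewrite /K; lra.
have d0 : 0 < Num.min 1 (e / K) by rewrite lt_min ltr01 divr_gt0.
apply: filterS2 (fa _ d0) (gb _ d0) => t; set d := Num.min _ _ => ft gt.
have d1 : d <= 1 by rewrite ge_min lexx.
have dK : d * K <= e by rewrite -ler_pdivlMr// ge_min lexx orbT.
have -> : a * b - f t * g t =
    (a - f t) * b + (a * (b - g t) - (a - f t) * (b - g t)).
  have fE : a - (a - f t) = f t by rewrite opprB addrC subrK.
  by rewrite -[a * (b - g t) - _]mulrBl fE mulrBl mulrBr addrA subrK.
apply: le_lt_trans (rnormD _ _) _.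
apply: le_lt_trans (lerD (lexx _) (rnormB _ _)) _.
have h1 := rnormM (a - f t) b; have h2 := rnormM a (b - g t).
have h3 := rnormM (a - f t) (b - g t).
have h4 : rnorm (a - f t) * rnorm b <= d * rnorm b.
  by rewrite ler_wpM2r ?rnorm_ge0// ltW.
have h5 : rnorm a * rnorm (b - g t) <= rnorm a * d.
  by rewrite ler_wpM2l ?rnorm_ge0// ltW.
have h6 : rnorm (a - f t) * rnorm (b - g t) <= rnorm (a - f t).
  by rewrite ler_piMr ?rnorm_ge0// (le_trans (ltW gt)).
rewrite (lt_le_trans _ dK)// /K.
by move: h1 h2 h3 h4 h5 h6 ft; lra.
Qed.

(** Bilinearity is declared for the operation of the structure, since the generic
ring multiplication already carries this structure for commutative scalars. *)
Lemma bmul_is_bilinear : bilinear_for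
  (GRing.Scale.Law.clone _ _ *:%R _) (GRing.Scale.Law.clone _ _ *:%R _)
  (@bmul R A).
Proof.
split=> [y|x] c u v /=.
- by rewrite bmulDl bmul_scaleAl.
- by rewrite bmulDr bmul_scaleAr.
Qed.

HB.instance Definition _ :=
  bilinear_isBilinear.Build R[i] A A A _ _ (@bmul R A) bmul_is_bilinear.

Section pointwise.
Context {V : normedModType R[i]} (x : V).
Implicit Types f g : V -> A.

Lemma differentiable_balgM f g : differentiable f x -> differentiable g x ->
  differentiable (fun t => f t * g t) x.
Proof.
move=> df dg.
have mc : continuous (fun q : A * A => bmul q.1 q.2).
  by move=> q; apply: cvg_balgM; [exact: cvg_fst|exact: cvg_snd].
apply: (@differentiable_comp _ _ _ _ (fun t => (f t, g t))
  (fun q : A * A => bmul q.1 q.2)).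
  exact: differentiable_pair.
exact: differentiable_bilin.
Qed.

Lemma differentiable_balgB f g : differentiable f x -> differentiable g x ->
  differentiable (fun t => f t - g t) x.
Proof. exact: differentiableB. Qed.

Lemma differentiable_balgD f g : differentiable f x -> differentiable g x ->
  differentiable (fun t => f t + g t) x.
Proof. exact: differentiableD. Qed.

End pointwise.

(** The partial sums of the Neumann series are iterates of w |-> 1 + u w. Since they
commute with u, their limit solves both w = 1 + u w and w = 1 + w u, which makes
it a two-sided inverse of 1 - u. *)
Section Neumann.
Variable u : A.
Hypothesis u1 : rnorm u < 1.

Let s n : A := iter n (fun w => 1 + u * w) 0.

(* The tails of the series, from which the Cauchy property follows. *)
Let sB n k : s (n + k) - s n = u ^+ n * s k.
Proof.
elim: n => [|n ih]; first by rewrite add0n expr0 mul1r subr0.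
by rewrite exprS -mulrA -ih mulrBr opprD addrACA subrr add0r.
Qed.

Let s_comm n : u * s n = s n * u.
Proof.
elim: n => [|n ih]; first by rewrite mulr0 mul0r.
by rewrite /= mulrDr mulr1 mulrDl mul1r -mulrA -ih.
Qed.

Let s_bound k : rnorm (s k) <= rnorm (1 : A) / (1 - rnorm u).
Proof.
have u0 : 0 < 1 - rnorm u by rewrite subr_gt0.
elim: k => [|k ih]; first by rewrite rnorm0 divr_ge0// ?rnorm_ge0 ?ltW.
rewrite /= (le_trans (rnormD _ _))// (le_trans (lerD (lexx _) (rnormM _ _)))//.
rewrite (le_trans (lerD (lexx _) (ler_wpM2l (rnorm_ge0 u) ih)))//.
set C := _ / _; have -> : rnorm (1 : A) = C * (1 - rnorm u).
  by rewrite /C divfK// gt_eqF.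
by rewrite mulrBr mulr1 [rnorm u * C]mulrC subrK.
Qed.

Let rnormX n : rnorm (u ^+ n) <= rnorm (1 : A) * rnorm u ^+ n.
Proof.
elim: n => [|n ih]; first by rewrite !expr0 mulr1.
rewrite exprS (le_trans (rnormM _ _))// exprS mulrCA.
by rewrite ler_wpM2l ?rnorm_ge0.
Qed.

Let s_cauchy : cauchy (s @ \oo).
Proof.
apply/rnorm_cauchyP => e e0.
pose K := rnorm (1 : A) * (rnorm (1 : A) / (1 - rnorm u)) + 1.
have K0 : 0 < K.
  by rewrite ltr_wpDl// mulr_ge0 ?divr_ge0 ?rnorm_ge0// subr_ge0 ltW.
have /cvgrPdist_lt/(_ (e / K)) : (GRing.exp (rnorm u) : R ^nat) @ \oo --> (0 : R).
  by apply: cvg_expr; rewrite ger0_norm ?rnorm_ge0.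
rewrite divr_gt0// => /(_ isT)[N _ /(_ N (leqnn N))].
rewrite /= sub0r normrN ger0_norm ?exprn_ge0 ?rnorm_ge0// => uN.
exists (s N), N => // n /= Nn.
rewrite rnorm_distC -(subnKC Nn) sB (le_lt_trans (rnormM _ _))//.
rewrite ltr_pdivlMr// in uN; rewrite (le_lt_trans _ uN)//.
apply: le_trans (ler_pM _ _ (rnormX N) (s_bound _)) _; rewrite ?rnorm_ge0//.
rewrite [_ * rnorm u ^+ N]mulrC -mulrA ler_wpM2l ?exprn_ge0 ?rnorm_ge0//.
by rewrite lerDl.
Qed.

Lemma invertible_1B : invertible (1 - u).
Proof.
have /cvg_ex[w sw] : cvg (s @ \oo) by exact: cauchy_cvg.
have sSw : (fun n => s n.+1) @ \oo --> w by rewrite (cvg_shiftS s (nbhs w)).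
have usw : (fun n => s n.+1) @ \oo --> 1 + u * w.
  by apply: cvgD; [exact: cvg_cst|apply: cvg_balgM => //; exact: cvg_cst].
have swu : (fun n => s n.+1) @ \oo --> 1 + w * u.
  rewrite (_ : (fun n => s n.+1) = (fun n => 1 + s n * u)); last first.
    by apply/funext => n; rewrite -s_comm.
  by apply: cvgD; [exact: cvg_cst|apply: cvg_balgM => //; exact: cvg_cst].
have uw : w = 1 + u * w := cvg_unique (@norm_hausdorff _ A) sSw usw.
have wu : w = 1 + w * u := cvg_unique (@norm_hausdorff _ A) sSw swu.
exists w; split; first by rewrite mulrBl mul1r {1}uw addrK.
by rewrite mulrBr mulr1 {1}wu addrK.
Qed.

End Neumann.

Lemma rnorm_inverse_1B u : rnorm u <= 1 / 2 ->
  rnorm (inverse (1 - u)) <= 2 * rnorm (1 : A).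
Proof.
move=> u2; have ui : invertible (1 - u) by apply: invertible_1B; lra.
have E : inverse (1 - u) = 1 + u * inverse (1 - u).
  by rewrite -{2}(mul_inverse ui) -mulrDl subrK mul1r.
have h1 : rnorm (inverse (1 - u)) <= rnorm (1 : A) + rnorm (u * inverse (1 - u)).
  by rewrite {1}E rnormD.
have h2 := rnormM u (inverse (1 - u)).
have h3 : rnorm u * rnorm (inverse (1 - u)) <= 1 / 2 * rnorm (inverse (1 - u)).
  by rewrite ler_wpM2r ?rnorm_ge0.
by move: h1 h2 h3; lra.
Qed.

(** Near an invertible a with inverse b, h + a = a (1 + b h) and the second factor is
inverted by a Neumann series as soon as the norm of b h is at most 1/2. *)
Section inverse_near.
Variable a : A.
Hypothesis ai : invertible a.
Let b := inverse a.
Let d := (2 * (rnorm b + 1))^-1.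

Let d_gt0 : 0 < d.
Proof. by rewrite invr_gt0 mulr_gt0// ltr_wpDl ?rnorm_ge0. Qed.

Let small h : rnorm h < d -> rnorm (- (b * h)) <= 1 / 2.
Proof.
move=> hd; rewrite rnormN (le_trans (rnormM _ _))//.
have : rnorm b * rnorm h <= rnorm b * d by rewrite ler_wpM2l ?rnorm_ge0// ltW.
have : (rnorm b + 1) * d = 1 / 2.
  by rewrite /d invfM mulrCA mulfV ?mulr1 ?div1r// gt_eqF// ltr_wpDl ?rnorm_ge0.
by have := d_gt0; lra.
Qed.

Let factor h : rnorm h < d ->
  mutually_inverse (h + a) (inverse (1 - - (b * h)) * b).
Proof.
move=> /small hb; have -> : h + a = a * (1 - - (b * h)).
  by rewrite opprK mulrDr mulr1 mulrA mul_inverse// mul1r addrC.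
apply: mutually_inverseM; apply: inverseP => //.
by apply: invertible_1B; lra.
Qed.

Lemma nbhs_invertible : nbhs a (@invertible A).
Proof.
have idc : (id : A -> A) @ a --> a by exact: cvg_id.
have /rnorm_cvgP/(_ _ d_gt0) := idc; apply: filterS => x.
rewrite rnorm_distC => /factor; rewrite subrK => xi.
by exists (inverse (1 - - (b * (x - a))) * b).
Qed.

(** The derivative is h |-> - b h b: for w the inverse of h + a, applying
w - b = - w h b twice leaves the remainder w h b h b, which is quadratic in h as
w stays bounded. *)
Lemma differentiable_inverse : differentiable (@inverse A) a.
Proof.
have Ll : linear (fun h => - (b * h * b)).
  move=> k x y; rewrite mulrDr mulrDl opprD scalerN.
  rewrite -[b * (k *: x)]bmul_scaleAr.
  by rewrite -[(k *: (b * x)) * b]bmul_scaleAl.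
pose L : {linear A -> A} := HB.pack (fun h => - (b * h * b))
  (GRing.isLinear.Build _ _ _ _ _ Ll).
apply: (@differentiable_quadratic_remainder _ _ _ _ _ L
  (2 * rnorm (1 : A) * rnorm b * rnorm b * rnorm b) d) => //.
  move=> h; apply: cvgN; apply: cvg_balgM; last exact: cvg_cst.
  by apply: cvg_balgM; [exact: cvg_cst|exact: cvg_id].
move=> h hd; have hi := factor hd; rewrite (inverse_uniq hi).
set w := _ * b.
have wb : w - b = - (w * h * b).
  have -> : h = (h + a) - a by rewrite addrK.
  by rewrite mulrBr mulrBl (proj2 hi) mul1r -mulrA mul_inverse// mulr1 opprB.
have -> : w - (inverse a + L h) = w * h * b * h * b.
  have -> : L h = - (b * h * b) by [].
  rewrite opprD opprK addrA -/b wb addrC -!mulrBl.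
  by rewrite -opprB wb opprK.
have wn : rnorm w <= 2 * rnorm (1 : A) * rnorm b.
  rewrite (le_trans (rnormM _ _))// ler_wpM2r ?rnorm_ge0//.
  by apply: rnorm_inverse_1B; exact: small.
apply: (@le_trans _ _ (rnorm w * rnorm h * rnorm b * rnorm h * rnorm b)).
  do 3 rewrite (le_trans (rnormM _ _))// ler_wpM2r ?rnorm_ge0//.
  exact: rnormM.
rewrite [leLHS](_ : _ = rnorm w * (rnorm b * rnorm h) ^+ 2); last by ring.
rewrite [leRHS](_ : _ = 2 * rnorm (1 : A) * rnorm b * (rnorm b * rnorm h) ^+ 2).
  by rewrite ler_wpM2r// sqr_ge0.
by ring.
Qed.

End inverse_near.

End banach_algebra.

(** * The charts are holomorphic *)
Section chart_is_holomorphic.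
Context {R : realType} {A : banachAlgebraType R}.
Variable p : A.
Hypothesis pp : idempotents p.

Section pointwise.
Context {V : normedModType R[i]} (x : V).
Implicit Types f : V -> A.

Lemma differentiable_inverse_fun f : differentiable f x -> invertible (f x) ->
  differentiable (fun t => inverse (f t)) x.
Proof.
move=> df fi; apply: (@differentiable_comp _ _ _ _ f (@inverse A)) => //.
exact: differentiable_inverse.
Qed.

Lemma differentiable_diag f : differentiable f x ->
  differentiable (fun t => diag p (f t)) x.
Proof.
move=> df; apply: differentiable_balgD;
  by apply: differentiable_balgM => //; apply: differentiable_balgM.
Qed.

Lemma differentiable_offdiag f : differentiable f x ->
  differentiable (fun t => offdiag p (f t)) x.
Proof.
by move=> df; apply: differentiable_balgB => //; exact: differentiable_diag.
Qed.

Lemma differentiable_intertwiner f : differentiable f x ->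
  differentiable (fun t => intertwiner p (f t)) x.
Proof.
by move=> df; apply: differentiable_balgD => //; apply: differentiable_balgM.
Qed.

End pointwise.

Lemma chart_holomorphic : holomorphic_on (chart_dom p) (chart p).
Proof.
move=> x [gi di].
have dx : differentiable (id : A -> A) x by [].
have dg := differentiable_intertwiner dx.
have dd := differentiable_diag dg.
have dv : differentiable (frame p) x.
  by apply: differentiable_balgM => //; exact: differentiable_inverse_fun.
have dw : differentiable (coframe p) x.
  by apply: differentiable_balgM => //; exact: differentiable_inverse_fun.
apply: differentiable_balgD; first exact: differentiable_balgB.
by apply: differentiable_balgB; exact: differentiable_balgM.
Qed.

(** Stated where the first condition of the chart codomain holds, this provides the
continuity that makes the second condition open. *)
Lemma chart_inv_holomorphic z : invertible (1 + offdiag p z) ->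
  differentiable (chart_inv p) z.
Proof.
move=> vi.
have dz : differentiable (id : A -> A) z by [].
have dv : differentiable (fun z => 1 + offdiag p z) z.
  by apply: differentiable_balgD => //; exact: differentiable_offdiag.
apply: differentiable_balgM => //; apply: differentiable_balgD.
  by apply: differentiable_balgM => //; exact: differentiable_inverse_fun.
exact: differentiable_diag.
Qed.

Lemma nbhs_invertible_fun (f : A -> A) (x : A) : differentiable f x ->
  invertible (f x) -> \forall t \near x, invertible (f t).
Proof.
move=> /differentiable_continuous fc fi.
by apply: fc; exact: nbhs_invertible.
Qed.

Lemma open_chart_dom : open (chart_dom p).
Proof.
rewrite openE => x [gi di]; have dx : differentiable (id : A -> A) x by [].
have dg := differentiable_intertwiner dx.
by apply: filterI; apply: nbhs_invertible_fun => //; exact: differentiable_diag.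
Qed.

Lemma open_chart_codom : open (chart_codom p).
Proof.
rewrite openE => z [vi di]; have dz : differentiable (id : A -> A) z by [].
apply: filterI; apply: nbhs_invertible_fun => //.
  by apply: differentiable_balgD => //; exact: differentiable_offdiag.
apply: differentiable_diag; apply: differentiable_intertwiner.
exact: chart_inv_holomorphic.
Qed.

Lemma chart_biholomorphism :
  biholomorphism (chart_dom p) (chart_codom p) (chart p) (chart_inv p).
Proof.
split; split.
- exact: open_chart_dom.
- exact: open_chart_codom.
- exact: chart_holomorphic.
- by move=> z [vi _]; exact: chart_inv_holomorphic.
- by move=> x; exact: chart_dom_codom.
- by move=> z; exact: chart_codom_dom.
- by move=> x; exact: chartK.
- by move=> z; exact: chart_invK.
Qed.

Lemma closed_subspace_kernel (f : A -> A) :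
  (forall (a : R[i]) x y, f (a *: x + y) = a *: f x + f y) -> continuous f ->
  closed_subspace [set x | f x = 0].
Proof.
move=> fl fc; split=> /=.
- by have := fl (-1) 0 0; rewrite !scaleN1r !addNr.
- by move=> a x y fx fy; rewrite fl fx fy scaler0 addr0.
- apply: (@closed_comp _ _ f [set 0]); first by move=> x _; exact: fc.
  exact/accessible_closed_set1/hausdorff_accessible/norm_hausdorff.
Qed.

Lemma diag_linear (a : R[i]) (x y : A) :
  diag p (a *: x + y) = a *: diag p x + diag p y.
Proof.
have dD (u v : A) : diag p (u + v) = diag p u + diag p v.
  by rewrite -{1}[v]opprK diagB -[- v]sub0r diagB diag0 sub0r opprK.
rewrite dD; congr (_ + _); rewrite /diag scalerDr.
rewrite -[p * (a *: x)]bmul_scaleAr -[(1 - p) * (a *: x)]bmul_scaleAr.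
rewrite -[(a *: (p * x)) * p]bmul_scaleAl.
by rewrite -[(a *: ((1 - p) * x)) * _]bmul_scaleAl.
Qed.

(** The off-diagonal elements p A (1 - p) + (1 - p) A p, complemented by the diagonal
ones. *)
Definition tangent_space : set A := [set x | diag p x = 0].

Lemma tangent_space_complemented : complemented_in tangent_space setT.
Proof.
have diagc : continuous (diag p).
  move=> x; apply: differentiable_continuous; exact: differentiable_diag.
have offc : continuous (offdiag p).
  move=> x; apply: differentiable_continuous; exact: differentiable_offdiag.
split=> //.
- by apply: closed_subspace_kernel => // a x y; exact: diag_linear.
exists [set x | offdiag p x = 0]; split=> //.
- apply: closed_subspace_kernel => // a x y.
  by rewrite /offdiag diag_linear scalerBr opprD addrACA.
- apply/seteqP; split=> [x [/= dx ox]|x ->] /=.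
    by rewrite -[x](subrK (diag p x)) -/(offdiag p x) ox dx addr0.
  by rewrite /offdiag diag0 subrr; split => //; exact: diag0.
- move=> z _; exists (offdiag p z), (diag p z); split.
  + exact: diag_offdiag.
  + by rewrite /= /offdiag (diag_id pp (comm_diag pp _)) subrr.
  + by rewrite subrK.
Qed.

Lemma chart_flattens_idempotents :
  flattens (chart_dom p) (chart p) (@idempotents A) tangent_space.
Proof. by move=> x Ux; exact: chart_idempotents. Qed.

Lemma chart_dom_similarity_class x : chart_dom p x ->
  similarity_class p x <-> idempotents x.
Proof.
move=> Ux; split; first exact: similarity_class_idempotent.
exact: chart_dom_similar.
Qed.

End chart_is_holomorphic.

(** * Similarity classes as submanifolds *)

Section similarity_orbits.
Context {R : realType} {A : banachAlgebraType R}.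
Implicit Types p q : A.

(** Each idempotent is the centre of its own chart. *)
Lemma idempotents_submanifold : holomorphic_submanifold (@idempotents A).
Proof.
move=> q qq; exists (chart_dom q), (chart_codom q), (chart q), (chart_inv q).
exists (tangent_space q); split.
- exact: chart_dom_id.
- exact: chart_biholomorphism.
- exact: tangent_space_complemented.
- exact: chart_flattens_idempotents.
Qed.

Lemma complemented_in_refl (E : set A) : closed_subspace E -> complemented_in E E.
Proof.
move=> Ec; have [E0 _ _] := Ec; split=> //; exists [set 0]; split.
- split=> //=; first by move=> a x y -> ->; rewrite scaler0 addr0.
  exact/accessible_closed_set1/hausdorff_accessible/norm_hausdorff.
- by move=> _ ->.
- by apply/seteqP; split=> [x []|x ->].
- by move=> z Ez; exists z, 0; split; rewrite ?addr0.
Qed.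

(** In the chart at q every idempotent is similar to q, so the class of q and the set
of all idempotents coincide on the chart domain and share their model space. *)
Lemma similarity_class_submanifold p : idempotents p ->
  holomorphic_submanifold_of (similarity_class p) (@idempotents A).
Proof.
move=> pp; split; first exact: similarity_class_idempotent.
move=> q pq; have qq : idempotents q := similarity_class_idempotent pp pq.
have Ec := tangent_space_complemented qq.
exists (chart_dom q), (chart_codom q), (chart q), (chart_inv q).
exists (tangent_space q), (tangent_space q); split; split.
- exact: chart_dom_id.
- exact: chart_biholomorphism.
- by [].
- by apply: complemented_in_refl; case: Ec.
- exact: chart_flattens_idempotents.
move=> z Uz; rewrite -(chart_flattens_idempotents qq Uz).
rewrite -(chart_dom_similarity_class qq Uz); split.
  by apply: similarity_class_trans; exact: similarity_class_sym.
exact: similarity_class_trans.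
Qed.

Lemma open_similarity_class p : idempotents p ->
  @open (subspace (@idempotents A)) (similarity_class p).
Proof.
move=> pp; apply/open_subspaceP.
exists (\bigcup_(q in similarity_class p) chart_dom q).
  by apply: bigcup_open => q _; exact: open_chart_dom.
apply/seteqP; split=> x [].
  move=> [q pq Ux] xx; split=> //; apply: (similarity_class_trans pq).
  by have qq := similarity_class_idempotent pp pq; exact: chart_dom_similar.
by move=> px xx; split=> //; exists x => //; exact: chart_dom_id.
Qed.

(** Among the idempotents, the complement is the union of the other similarity
classes, and each of them is open. *)
Lemma closed_similarity_class p : idempotents p ->
  @closed (subspace (@idempotents A)) (similarity_class p).
Proof.
move=> pp; apply/closed_subspaceP.
pose S := [set q : A | idempotents q /\ ~ similarity_class p q].
exists (~` \bigcup_(q in S) chart_dom q).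
  apply: open_closedC; apply: bigcup_open => q _; exact: open_chart_dom.
apply/seteqP; split=> x [].
  move=> xS xx; split=> //; apply: contrapT => npx; apply: xS.
  by exists x => //; exact: chart_dom_id.
move=> px xx; split=> // -[q [qq npq] Ux]; apply: npq.
apply: (similarity_class_trans px); apply: similarity_class_sym.
exact: chart_dom_similar.
Qed.

End similarity_orbits.

(** * The restricted algebra *)

HB.instance Definition _ (R : realType) (Y : compactMetricType R)
    (H : hilbertType R) (J : bounded_operator H) :=
  let A := cfun Y (restricted_operator J) in
  isBanachAlgebra.Build R (cfun Y (restricted_operator J))
    (@mulrA A) (@mul1r A) (@mulr1 A) (@mulrDl A) (@mulrDr A)
    (@cfun_scaleAl R Y H J) (@cfun_scaleAr R Y H J) (@cfun_normM R Y H J).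

Local Close Scope complex_scope.

Theorem proposition4p2 (R : realType) (H : hilbertType R)
    (H_separable : separable H) (H_infinite : infinite_dimensional H)
    (J : bounded_operator H) (J_unitary : unitary_operator J)
    (J_involution : J * J = 1)
    (Y : compactMetricType R)
    (p : cfun Y (restricted_operator J)) (p_idem : idempotents p) :
  let P : set (cfun Y (restricted_operator J)) := @idempotents _ in
  let Lambda : set (cfun Y (restricted_operator J)) := similarity_class p in
  [/\ holomorphic_submanifold P,
      Lambda `<=` P,
      @open (subspace P) Lambda,
      @closed (subspace P) Lambda
    & holomorphic_submanifold_of Lambda P].
Proof.
move=> P Lambda.
have [idem sub] : holomorphic_submanifold P /\ Lambda `<=` P.
  by split; [exact: idempotents_submanifold|exact: similarity_class_idempotent].
split=> //.
- exact: open_similarity_class.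
- exact: closed_similarity_class.
- exact: similarity_class_submanifold.
Qed.
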